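(* Assume the standing assumptions and Assumption PLAIN below. There is a constant $C_{GSR}$, depending only on the good grid $\mathcal P$ (and the fixed parameters $s,\beta,p,q$), with the following property. Suppose $\{I_r\}_{r\in\Lambda}$ is a family of pairwise disjoint $(1-\beta p,C_{rp},0)$-strongly regular domains, for some $C_{rp}>0$, and that $$C_{f}=C_{rp}^{1/p}\sum_{r\in\Lambda}\Theta_r<\infty.$$ Then every $\mathcal B^s_{p,q}(I,m,\mathcal P)$-representation of every function in $\mathcal B^s_{p,q}(I,m,\mathcal P)$ has a $C_{GSR}C_f$-regular slicing.
   Context: Grids. Let $(X,\nu)$ be a measure space with $\nu(X)=1$; write $|A|=\nu(A)$. A grid on $X$ is a sequence $\mathcal P=(\mathcal P^k)_{k\ge0}$ of finite families of measurable sets of positive measure, at least one nonempty, with $\sup_k\sup_{Q\in\mathcal P^k}\#\{P\in\mathcal P^k:P\cap Q\ne\emptyset\}<\infty$. For $0<c_1<c_2<1$ it is a good grid if moreover: $\mathcal P^0=\{X\}$; for each $k$ the sets of $\mathcal P^k$ are pairwise disjoint and cover $X$ up to a null set; each $Q\in\mathcal P^k$, $k\ge1$, is contained in some $P\in\mathcal P^{k-1}$; $c_1\le |Q|/|P|\le c_2$ whenever $Q\in\mathcal P^{k+1}$, $P\in\mathcal P^k$, $Q\subset P$; and $\bigcup_k\mathcal P^k$ generates the $\sigma$-algebra. Write $Q\in\mathcal P$ for $Q\in\bigcup_k\mathcal P^k$, and $k_0(\Omega,\mathcal P)=\min\{k\ge0:\exists P\in\mathcal P^k,\ P\subset\Omega\}$.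 Besov spaces. For $Q\in\mathcal P$ and $\sigma>0$ let $a^\sigma_Q=|Q|^{\sigma-1/p}1_Q$ and $a_Q:=a^s_Q$. For coefficients $(d_Q)$ let $\|(d_Q)\|_{p,q}=\big(\sum_k(\sum_{Q\in\mathcal P^k}|d_Q|^p)^{q/p}\big)^{1/q}$ ($\sup_k$ if $q=\infty$). A $\mathcal B^\sigma_{p,q}(X,\nu,\mathcal P)$-representation of $f\in L^p(\nu)$ is an expansion $f=\sum_k\sum_{Q\in\mathcal P^k}d_Qa^\sigma_Q$, $d_Q\in\mathbb C$, with $\sum_k|\sum_{Q\in\mathcal P^k}d_Qa^\sigma_Q|_{L^p}<\infty$ and $\|(d_Q)\|_{p,q}<\infty$; $\mathcal B^\sigma_{p,q}(X,\nu,\mathcal P)$ is the space of such $f$ with norm $\inf\|(d_Q)\|_{p,q}$ (same definition for a grid on a subset). For $W\in\mathcal P$, $|g|_{\mathcal B^\sigma_{p,q}(W)}$ is the infimum of $\|(d_Q)\|_{p,q}$ over representations of $g$ using only sets $Q\subset W$. Regular domain. $\Omega\subset J$ is an $(\alpha,C,\lambda)$-regular domain in $(J,\mathcal H)$ if there are families $\mathcal F^k(\Omega)\subset\mathcal H^k$, $k\ge k_0(\Omega,\mathcal H)$, all of whose members are pairwise disjoint, with union $\Omega$, and $\sum_{Q\in\mathcal F^k(\Omega)}|Q|^\alpha\le C\lambda^{k-k_0(\Omega,\mathcal H)}|\Omega|^\alpha$. Strongly regular domain. $\Omega\subset I$ is an $(\alpha,C,t)$-strongly regular domain (w.r.t.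 $\mathcal P$) if for each $Q\in\mathcal P^i$ with $i\ge t$ there are families $\mathcal F^k(Q\cap\Omega)\subset\mathcal P^k$, $k\ge k_0(Q\cap\Omega,\mathcal P)$, all of whose members are pairwise disjoint, with union $Q\cap\Omega$, and $\sum_{P\in\mathcal F^k(Q\cap\Omega)}|P|^\alpha\le C|Q|^\alpha$ for every $k$. Branch. For measurable $\hat J\subset J$, $\hat I\subset I$, a $(s,p,a,\tilde\epsilon,C_{DGD1},C_{DGD2},C_{DC1},C_{DC2},\mathcal G)$-branch ($C_{DGD2},C_{DC2}\in(0,1)$) is a bijection $h:\hat J\to\hat I$ with $h,h^{-1}$ measurable, $\mathcal G$ a grid on $(\hat I,m)$, with: (I) $m(Q)=0$ iff $\mu(h^{-1}Q)=0$; (II) for $Q\in\mathcal G$, $h^{-1}(Q)$ is a $(1-sp,C_{DGD1},C_{DGD2})$-regular domain in $(J,\mathcal H)$; (III) for $Q\in\mathcal G$, $|k_0(Q,\mathcal G)-k_0(h^{-1}Q,\mathcal H)|\ge a$ and $(|Q|/|h^{-1}Q|)^{\tilde\epsilon/|\tilde\epsilon|}\le C_{DC1}C_{DC2}^{|k_0(Q,\mathcal G)-k_0(h^{-1}Q,\mathcal H)|}$; (IV) $\hat I$ is up to a null set a countable union of elements of $\mathcal P$; (V) for $W\in\mathcal G$, $W\subset\hat I$, $h^{-1}(W)$ is up to a null set a countable union of elements of $\mathcal H$. Regular potential. $g:\hat J\to\mathbb C$ is a $(C_{DRP},\beta,\tilde\epsilon)$-regular potential for $h$ if $|g1_W|_{\mathcal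 B^\beta_{p,q}(W)}\le C_{DRP}(|Q|/|h^{-1}Q|)^{1/p-s+\tilde\epsilon}|W|^{1/p-\beta}$ for all $W\in\mathcal H$, $Q\in\mathcal G$ with $W\subset\hat J$, $Q\subset\hat I$, $h(W)\subset Q$. Standing assumptions. $(I,m,\mathcal P)$ and $(J,\mu,\mathcal H)$ are probability spaces with good grids; $p\in[1,\infty)$, $q\in[1,\infty]$, $\epsilon>0$, $\gamma\in[0,1]$, $s,\beta,\delta>0$ with $s+\epsilon\le1/p$, $s<\beta<1/p$, $0<\delta<\max\{s,\epsilon\}$; $t_0=p/(1-sp+\delta p)$. $\Lambda\subset\mathbb N$; for $r\in\Lambda$, $I_r\subset I$, $J_r\subset J$ measurable, $h_r:J_r\to I_r$ a $(s,p,a_r,\epsilon_r,C^r_{DGD1},C^r_{DGD2},C^r_{DC1},C^r_{DC2},\mathcal G_r)$-branch with $|\epsilon_r|=\epsilon$, $g_r:J_r\to\mathbb C$ a $(C^r_{DRP},\beta,\epsilon_r)$-regular potential for $h_r$. The family $\{Q\in\mathcal G_r:Q\subset I_r,r\in\Lambda\}\cup\{Q\in\mathcal P:Q\cap I_r=\emptyset\ \forall r\}$ generates the $\sigma$-algebra of $I$. $C^r_{DRS2}=\max\{(C^r_{DC2})^\epsilon,(C^r_{DGD2})^{1/p}\}$, $\sup_rC^r_{DRS2}<1$. $\Theta_r=(C^r_{DC1})^\epsilon C^r_{DRP}(C^r_{DGD1})^{1/p}(C^r_{DRS2})^{a_r(1-\gamma)}$. $\Phi_r f(x)=g_r(x)f(h_r(x))$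 on $J_r$, $0$ elsewhere; $\Phi=\sum_r\Phi_r$; there is $C\ge0$ with $\sum_r|\Phi_rf|_{L^1(\mu)}\le C|f|_{L^{t_0}(m)}$ for $f\in L^{t_0}(m)$. Assumption PLAIN: for every $r\in\Lambda$ and $k$, $\mathcal G_r^k=\{P\in\mathcal P^k:P\subset I_r\}$. Regular slicing. Let $N=\sup_{P\in\mathcal H}\#\{r\in\Lambda:P\subset J_r\}$, $1/p+1/p'=1$, $N^{1/p'}:=1$ if $p=1$. For $C_{DRS1}\ge0$, a $\mathcal B^s_{p,q}(I,m,\mathcal P)$-representation $f=\sum_k\sum_{Q\in\mathcal P^k}d_Qa_Q$ has a $C_{DRS1}$-regular slicing if for every $r\in\Lambda$ there is a $\mathcal B^s_{p,q}(I_r,m,\mathcal G_r)$-representation $f1_{I_r}=\sum_j\sum_{Q\in\mathcal G_r^j,Q\subset I_r}c^r_Qa_Q$ such that either (S1) $\Big(\sum_j\big(\sum_r\Theta_r(\sum_{Q\in\mathcal G_r^j,Q\subset I_r}|c^r_Q|^p)^{1/p}\big)^q\Big)^{1/q}\le C_{DRS1}\|(d_Q)\|_{p,q}$, or (S2) $N^{1/p'}\Big(\sum_j\big(\sum_r\Theta_r^p\sum_{Q\in\mathcal G_r^j,Q\subset I_r}|c^r_Q|^p\big)^{q/p}\Big)^{1/q}\le C_{DRS1}\|(d_Q)\|_{p,q}$, and such that, if $d_Q\ge0$ for all $Q$, the $c^r_Q$ can be chosen $\ge0$. *)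

(* Defs.v *)
From HB Require Import structures.
From mathcomp Require Import all_boot all_order all_algebra.
From mathcomp Require Import all_classical all_reals all_analysis.
From mathcomp Require Import complex.

Set Implicit Arguments.
Unset Strict Implicit.
Unset Printing Implicit Defensive.

Import Order.TTheory GRing.Theory Num.Theory.
Local Open Scope classical_set_scope.
Local Open Scope ring_scope.

Section Defs.
Context {R : realType}.
Local Notation C := R[i].

Definition cabs (z : C) : R :=
  Num.sqrt (complex.Re z ^+ 2 + complex.Im z ^+ 2).

Definition cofR (x : R) : C := Complex x 0.

Definition cind {T : Type} (A : set T) (x : T) : C :=
  if `[< A x >] then 1 else 0.

Definition lq (q : \bar R) (u : nat -> \bar R) : \bar R :=
  match q with
  | r%:E => ((\sum_(j <oo) (u j) `^ r) `^ r^-1)%E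
  | _ => ereal_sup (range u)
  end.

Section OnSpace.
Context {d : measure_display} {T : measurableType d}.

Definition msr (mu : {measure set T -> \bar R}) (A : set T) : R := fine (mu A).

Definition cmeasurable (D : set T) (f : T -> C) : Prop :=
  measurable_fun D (fun x => complex.Re (f x)) /\
  measurable_fun D (fun x => complex.Im (f x)).

Definition Lpn (mu : {measure set T -> \bar R}) (p : R) (f : T -> C) : \bar R :=
  ((\int[mu]_x ((cabs (f x)) `^ p)%:E) `^ p^-1)%E.

Definition inLp (mu : {measure set T -> \bar R}) (p : R) (f : T -> C) : Prop :=
  cmeasurable setT f /\ (\int[mu]_x ((cabs (f x)) `^ p)%:E < +oo)%E.

Definition gridT := nat -> set (set T).

Definition in_grid (G : gridT) (Q : set T) : Prop := exists k, G k Q.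

Definition is_grid (mu : {measure set T -> \bar R}) (A : set T) (G : gridT) : Prop :=
  [/\ (forall k, finite_set (G k)),
      (forall k Q, G k Q -> [/\ Q `<=` A, measurable Q & (0 < mu Q)%E]),
      (exists k, G k !=set0) &
      (exists M : nat, forall k Q, G k Q ->
          \sum_(P \in [set P | G k P /\ P `&` Q !=set0]) (1 : R) <= M%:R)].

Definition good_grid (mu : {measure set T -> \bar R}) (G : gridT) (c1 c2 : R) : Prop :=
  [/\ is_grid mu setT G,
      0 < c1 /\ c1 < c2 /\ c2 < 1,
      G 0%N = [set setT],
      (forall k Q1 Q2, G k Q1 -> G k Q2 -> Q1 <> Q2 -> Q1 `&` Q2 = set0) &
      (forall k, mu (~` \bigcup_(Q in G k) Q) = 0%E)] /\
  [/\ (forall k Q, G k.+1 Q -> exists P, G k P /\ Q `<=` P),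
      (forall k Q P, G k.+1 Q -> G k P -> Q `<=` P ->
          c1 <= msr mu Q / msr mu P <= c2) &
      (forall A, measurable A <-> <<s \bigcup_k G k >> A)].

Definition is_k0 (G : gridT) (Om : set T) (k : nat) : Prop :=
  (exists Q, G k Q /\ Q `<=` Om) /\
  (forall j Q, G j Q -> Q `<=` Om -> (k <= j)%N).

Definition decomp (G : gridT) (Om : set T) (F : gridT) : Prop :=
  [/\ (forall k, F k `<=` G k),
      (forall i j Q Q', F i Q -> F j Q' -> (i <> j \/ Q <> Q') ->
          Q `&` Q' = set0) &
      \bigcup_k \bigcup_(Q in F k) Q = Om].

Definition regular_domain (mu : {measure set T -> \bar R}) (G : gridT)
    (alpha CC lambda : R) (Om : set T) : Prop :=
  exists k0, is_k0 G Om k0 /\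
  exists F, decomp G Om F /\
    (forall k, (k0 <= k)%N ->
       \sum_(Q \in F k) (msr mu Q) `^ alpha
         <= CC * lambda ^+ (k - k0) * (msr mu Om) `^ alpha).

Definition strongly_regular (mu : {measure set T -> \bar R}) (G : gridT)
    (alpha CC : R) (t : nat) (Om : set T) : Prop :=
  forall i Q, (t <= i)%N -> G i Q ->
    exists F, decomp G (Q `&` Om) F /\
      (forall k, \sum_(P \in F k) (msr mu P) `^ alpha <= CC * (msr mu Q) `^ alpha).

Definition atom (mu : {measure set T -> \bar R}) (sigma p : R) (Q : set T)
    (x : T) : C :=
  cofR ((msr mu Q) `^ (sigma - p^-1)) * cind Q x.

Definition level_sum (mu : {measure set T -> \bar R}) (G : gridT) (sigma p : R)
    (c : set T -> C) (k : nat) (x : T) : C :=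
  \sum_(Q \in G k) c Q * atom mu sigma p Q x.

Definition level_norm (G : gridT) (p : R) (c : set T -> C) (k : nat) : R :=
  (\sum_(Q \in G k) (cabs (c Q)) `^ p) `^ p^-1.

Definition coef_norm (G : gridT) (p : R) (q : \bar R) (c : set T -> C) : \bar R :=
  lq q (fun k => (level_norm G p c k)%:E).

Definition besov_rep (mu : {measure set T -> \bar R}) (G : gridT) (sigma p : R)
    (q : \bar R) (f : T -> C) (c : set T -> C) : Prop :=
  [/\ inLp mu p f,
      (\sum_(k <oo) Lpn mu p (level_sum mu G sigma p c k) < +oo)%E,
      (coef_norm G p q c < +oo)%E &
      (fun n => Lpn mu p (fun x => f x - \sum_(k < n) level_sum mu G sigma p c k x))
        @ \oo --> 0%E].

Definition sub_grid (G : gridT) (W : set T) : gridT :=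
  fun k => [set Q | G k Q /\ Q `<=` W].

Definition besov_semi (mu : {measure set T -> \bar R}) (G : gridT) (sigma p : R)
    (q : \bar R) (f : T -> C) (W : set T) : \bar R :=
  ereal_inf [set coef_norm (sub_grid G W) p q c | c in
             [set c | besov_rep mu (sub_grid G W) sigma p q f c]].

Definition ae_eq_set (mu : {measure set T -> \bar R}) (A B : set T) : Prop :=
  mu ((A `\` B) `|` (B `\` A)) = 0%E.

Definition ae_countable_union (mu : {measure set T -> \bar R}) (G : gridT)
    (A : set T) : Prop :=
  exists S : set (set T), [/\ countable S, S `<=` in_grid G &
                              ae_eq_set mu A (\bigcup_(Q in S) Q)].

End OnSpace.

Section Branch.
Context {dJ dI : measure_display} {TJ : measurableType dJ} {TI : measurableType dI}.
Variables (mu : {measure set TJ -> \bar R}) (H : @gridT _ TJ)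
          (m : {measure set TI -> \bar R}) (P : @gridT _ TI).

Definition preim (Jh : set TJ) (h : TJ -> TI) (Q : set TI) : set TJ :=
  Jh `&` h @^-1` Q.

Definition branch (s p : R) (a : nat) (eps CG1 CG2 CC1 CC2 : R) (G : @gridT _ TI)
    (Jh : set TJ) (Ih : set TI) (h : TJ -> TI) : Prop :=
  [/\ [/\ measurable Jh, measurable Ih, set_bij Jh Ih h, measurable_fun Jh h &
          (forall A, measurable A -> A `<=` Jh -> measurable (h @` A))],
      0 < CG2 < 1 /\ 0 < CC2 < 1 &
      is_grid m Ih G] /\
  [/\
      (forall Q, measurable Q -> Q `<=` Ih -> (m Q = 0%E <-> mu (preim Jh h Q) = 0%E)),
      (forall k Q, G k Q -> regular_domain mu H (1 - s * p) CG1 CG2 (preim Jh h Q)),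
      (forall k Q, G k Q -> exists k1 k2,
          [/\ is_k0 G Q k1, is_k0 H (preim Jh h Q) k2,
              (a <= maxn k1 k2 - minn k1 k2)%N &
              (msr m Q / msr mu (preim Jh h Q)) `^ (eps / `|eps|)
                <= CC1 * CC2 ^+ (maxn k1 k2 - minn k1 k2)]),
      ae_countable_union m P Ih &
      (forall k W, G k W -> W `<=` Ih -> ae_countable_union mu H (preim Jh h W))].

Definition regular_potential (s p : R) (q : \bar R) (G : @gridT _ TI)
    (Jh : set TJ) (Ih : set TI) (h : TJ -> TI) (g : TJ -> C)
    (CRP beta eps : R) : Prop :=
  forall kW W kQ Q, H kW W -> G kQ Q -> W `<=` Jh -> Q `<=` Ih -> h @` W `<=` Q ->
    (besov_semi mu H beta p q (fun x => (g x * cind W x)%R) W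
      <= (CRP * (msr m Q / msr mu (preim Jh h Q)) `^ (p^-1 - s + eps)
              * (msr mu W) `^ (p^-1 - beta))%:E)%E.

Definition transfer (Jh : set TJ) (h : TJ -> TI) (g : TJ -> C) (f : TI -> C)
    (x : TJ) : C :=
  if `[< Jh x >] then g x * f (h x) else 0.

Definition overlapN (Lam : set nat) (Jr : nat -> set TJ) : \bar R :=
  ereal_sup [set (\esum_(r in [set r | Lam r /\ Q `<=` Jr r]) 1)%E | Q in in_grid H].

Definition regular_slicing (s p : R) (q : \bar R) (Lam : set nat)
    (Ir : nat -> set TI) (G : nat -> @gridT _ TI) (Theta : nat -> R) (N : \bar R)
    (CDRS1 : R) (f : TI -> C) (dc : set TI -> C) : Prop :=
  exists c : nat -> set TI -> C,
    [/\ (forall r, Lam r -> besov_rep m (G r) s p q (fun x => f x * cind (Ir r) x) (c r)),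
        (lq q (fun j => \esum_(r in Lam) (Theta r * level_norm (G r) p (c r) j)%:E)
           <= (CDRS1%:E * coef_norm P p q dc))%E
        \/
        ((if p == 1%R then 1 else N `^ (1 - p^-1)) *
           lq q (fun j => (\esum_(r in Lam)
                    ((Theta r) `^ p * \sum_(Q \in G r j) (cabs (c r Q)) `^ p)%:E) `^ p^-1)
           <= (CDRS1%:E * coef_norm P p q dc))%E &
        ((forall k Q, P k Q -> 0 <= dc Q) ->
           forall r j Q, Lam r -> G r j Q -> 0 <= c r Q)].

End Branch.

Definition CDRS2 (eps p CG2 CC2 : R) : R :=
  Num.max (CC2 `^ eps) (CG2 `^ p^-1).

Definition Theta (eps p gamma : R) (a : nat) (CG1 CG2 CC1 CC2 CRP : R) : R :=
  CC1 `^ eps * CRP * CG1 `^ p^-1 * (CDRS2 eps p CG2 CC2) `^ (a%:R * (1 - gamma)).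

End Defs.

(* Main.v *)
Require Import Defs.
From HB Require Import structures.
From mathcomp Require Import all_boot all_order all_algebra finmap.
From mathcomp Require Import all_classical all_reals all_analysis.
From mathcomp Require Import complex measurable_realfun.
Import Order.TTheory GRing.Theory Num.Theory.
Local Open Scope classical_set_scope.
Local Open Scope ring_scope.

(* Cut every cell [Q] of the representation along the decomposition of [Q `&` I_r]
   provided by strong regularity: the indicator of [Q `&` I_r] is the sum of the
   indicators of its pieces, so [f 1_{I_r}] inherits an expansion over the cells
   contained in [I_r].  A level-[k] piece of a level-[i] cell [Q] has [i <= k] and
   measure at most [c2^(k-i) |Q|], so strong regularity bounds the level-[k]
   coefficient norm by [C_rp^(1/p) sum_(i <= k) lam^(k-i) D_i], where [D_i] is the
   level-[i] norm of [(d_Q)] and [lam = c2^(beta-s) < 1].  Young's inequality for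
   this geometric convolution gives (S1) with the constant [1 / (1 - lam)].  What
   is lost by keeping only the pieces of level below [n] of the cells of level
   below [n] is [O(c2^(s n))] in [L^p], whence convergence of the new expansion. *)

Set Implicit Arguments.
Unset Strict Implicit.
Unset Printing Implicit Defensive.

(** * The modulus, complex indicators, and sums with at most one nonzero term *)

Section ComplexModulus.
Context {R : realType}.
Implicit Types (x y : R) (z w : R[i]).

Lemma cabsE z : cabs z = ComplexField.Normc.normc z.
Proof. by case: z. Qed.

Lemma cabs_ge0 z : 0 <= cabs z.
Proof. exact: sqrtr_ge0. Qed.

Lemma cabs0 : cabs (0 : R[i]) = 0.
Proof. by rewrite cabsE ComplexField.Normc.normc0. Qed.

Lemma cabsM z w : cabs (z * w) = cabs z * cabs w.
Proof. by rewrite !cabsE ComplexField.Normc.normcM. Qed.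

Lemma cabsD z w : cabs (z + w) <= cabs z + cabs w.
Proof. by rewrite !cabsE le_normcD. Qed.

Lemma cabs_cofR x : 0 <= x -> cabs (cofR x) = x.
Proof. by move=> x0; rewrite /cabs /= expr0n addr0 sqrtr_sqr ger0_norm. Qed.

Lemma cofRM x y : cofR (x * y) = cofR x * cofR y.
Proof. by apply/eqP; rewrite eq_complex /= !(mulr0, mul0r, subr0, addr0) !eqxx. Qed.

Lemma cofR1 : cofR 1 = 1 :> R[i].
Proof. by []. Qed.

Lemma cofR_ge0 x : 0 <= x -> 0 <= cofR x.
Proof. by move=> x0; rewrite lecE /= eqxx. Qed.

Lemma cabs_cind T (A : set T) t : cabs (cind A t : R[i]) = \1_A t.
Proof.
rewrite /cind indicE; case: asboolP => At.
  by rewrite mem_set// cabsE ComplexField.Normc.normc1.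
by rewrite memNset// cabs0.
Qed.

Lemma cindI T (A B : set T) t : cind (A `&` B) t = cind A t * cind B t :> R[i].
Proof.
rewrite /cind; case: asboolP => [[At Bt]|nAB].
  by do 2 (case: asboolP => // _); rewrite mulr1.
case: asboolP => At; last by rewrite mul0r.
by case: asboolP => Bt; [case: nAB | rewrite mulr0].
Qed.

Lemma cindU T (A B : set T) t : A `&` B = set0 ->
  cind (A `|` B) t = cind A t + cind B t :> R[i].
Proof.
move=> AB0; have nAB : ~ (A t /\ B t) by move=> ABt; suff: set0 t by []; rewrite -AB0.
rewrite /cind; case: (asboolP ((A `|` B) t)) => ABt; case: (asboolP (A t)) => At;
  case: (asboolP (B t)) => Bt; rewrite ?(addr0, add0r)//.
- by case: nAB.
- by case: ABt.
- by case: ABt; left.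
- by case: ABt; left.
- by case: ABt; right.
Qed.

Lemma cind_out T (A : set T) t : ~ A t -> cind A t = 0 :> R[i].
Proof. by rewrite /cind; case: asboolP. Qed.

End ComplexModulus.

(** Meant for the p-th power of a modulus: over disjoint cells only one term survives, so the power
    passes inside the sum with equality. *)
Lemma fsum_comp_single (I : choiceType) (V W : nmodType) (D : set I)
    (z : I -> V) (phi : V -> W) :
  finite_set D -> phi 0 = 0 ->
  (forall i j, D i -> D j -> z i <> 0 -> z j <> 0 -> i = j) ->
  phi (\sum_(i \in D) z i) = \sum_(i \in D) phi (z i).
Proof.
move=> finD phi0 uniqz; rewrite !fsbig_finite//.
have [/hasP[i iD /eqP zi0]|/hasPn z0] :=
    boolP (has (fun i => z i != 0) (enum_fset (fset_set D))); last first.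
  have {}z0 i : i \in fset_set D -> z i = 0 by move=> /z0; rewrite negbK => /eqP.
  rewrite [X in phi X]big1_seq => [|i /andP[_ /z0]//].
  by rewrite big1_seq => [//|i /andP[_ /z0->]].
have {}z0 j : (j != i) && (j \in fset_set D) -> z j = 0.
  move=> /andP[/eqP ji jD]; apply/eqP/negP => /negP/eqP zj0.
  have DE k : k \in fset_set D -> D k by rewrite in_fset_set// inE.
  by case: ji; apply: uniqz => //; exact: DE.
rewrite (bigD1_seq i)//= [X in _ = X](bigD1_seq i)//=.
rewrite [X in z i + X]big1_seq => [|j /z0//].
by rewrite addr0 [X in phi (z i) + X]big1_seq => [|j /z0->//]; rewrite addr0.
Qed.

(** * Measurability and L^p seminorms of complex functions *)

Section ComplexLp.
Context {R : realType} {d : measure_display} {T : measurableType d}.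
Variable mu : probability T R.
Implicit Types (f g : T -> R[i]) (p : R).

Lemma cmeasurable_cabs f : cmeasurable setT f ->
  measurable_fun setT (fun x => cabs (f x)).
Proof.
move=> [mr mi]; rewrite /cabs.
have mQ : measurable_fun setT
    (fun x => complex.Re (f x) ^+ 2 + complex.Im (f x) ^+ 2).
  by apply: measurable_funD; exact: measurable_funX.
exact (measurableT_comp (continuous_measurable_fun (@sqrt_continuous R)) mQ).
Qed.

Lemma cmeasurable_cabsX p f : cmeasurable setT f ->
  measurable_fun setT (fun x => cabs (f x) `^ p).
Proof. move=> /cmeasurable_cabs mf; exact (measurableT_comp (measurable_powR p) mf). Qed.

Lemma cmeasurable_cst (z : R[i]) : cmeasurable setT (fun _ : T => z).
Proof. by split; exact: measurable_cst. Qed.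

Lemma cmeasurable_cind (A : set T) : measurable A ->
  cmeasurable setT (cind A : T -> R[i]).
Proof.
move=> mA; split.
  rewrite (_ : (fun _ => _) = \1_A); first exact: measurable_indic.
  apply/funext => x; rewrite /cind indicE.
  by case: asboolP => At; [rewrite mem_set|rewrite memNset].
rewrite (_ : (fun _ => _) = cst 0); first exact: measurable_cst.
by apply/funext => x; rewrite /cind; case: asboolP.
Qed.

Lemma cmeasurableD f g : cmeasurable setT f -> cmeasurable setT g ->
  cmeasurable setT (fun x => f x + g x).
Proof.
move=> [fr fi] [gr gi]; split.
  rewrite (_ : (fun _ => _) = (fun x => complex.Re (f x) + complex.Re (g x))).
    exact: measurable_funD.
  by apply/funext => x; case: (f x) (g x) => ? ? [].
rewrite (_ : (fun _ => _) = (fun x => complex.Im (f x) + complex.Im (g x))).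
  exact: measurable_funD.
by apply/funext => x; case: (f x) (g x) => ? ? [].
Qed.

Lemma cmeasurableM f g : cmeasurable setT f -> cmeasurable setT g ->
  cmeasurable setT (fun x => f x * g x).
Proof.
move=> [fr fi] [gr gi]; split.
  rewrite (_ : (fun _ => _) = (fun x => complex.Re (f x) * complex.Re (g x) -
      complex.Im (f x) * complex.Im (g x))).
    by apply: measurable_funB; exact: measurable_funM.
  by apply/funext => x; case: (f x) (g x) => ? ? [].
rewrite (_ : (fun _ => _) = (fun x => complex.Re (f x) * complex.Im (g x) +
      complex.Im (f x) * complex.Re (g x))).
  by apply: measurable_funD; exact: measurable_funM.
by apply/funext => x; case: (f x) (g x) => ? ? [].
Qed.

Lemma cmeasurableB f g : cmeasurable setT f -> cmeasurable setT g ->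
  cmeasurable setT (fun x => f x - g x).
Proof.
move=> mf mg; rewrite (_ : (fun _ => _) = (fun x => f x + (-1) * g x)); last first.
  by apply/funext => x; rewrite mulN1r.
by apply: cmeasurableD => //; apply: cmeasurableM => //; exact: cmeasurable_cst.
Qed.

Lemma cmeasurable_sum (I : Type) (l : seq I) (h : I -> T -> R[i]) :
  (forall i, cmeasurable setT (h i)) ->
  cmeasurable setT (fun x => \sum_(i <- l) h i x).
Proof.
move=> mh; elim: l => [|i l IHl].
  by under eq_fun do rewrite big_nil; exact: cmeasurable_cst.
by under eq_fun do rewrite big_cons; exact: cmeasurableD.
Qed.

Lemma cmeasurable_fsum (I : choiceType) (D : set I) (v : I -> R[i]) (A : I -> set T) :
  finite_set D -> (forall i, D i -> measurable (A i)) ->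
  cmeasurable setT (fun x => \sum_(i \in D) v i * cind (A i) x).
Proof.
move=> finD mA.
rewrite (_ : (fun _ => _) = (fun x => \sum_(i <- fset_set D)
   (if i \in D then v i * cind (A i) x else 0))); last first.
  apply/funext => x; rewrite fsbig_finite//; apply: eq_big_seq => i.
  by rewrite in_fset_set// => ->.
apply: cmeasurable_sum => i; have [/set_mem Di|_] := boolP (i \in D); last exact: cmeasurable_cst.
by apply: cmeasurableM; [exact: cmeasurable_cst|exact/cmeasurable_cind/mA].
Qed.

Lemma Lpn_ge0 p f : (0 <= Lpn mu p f)%E.
Proof. exact: poweR_ge0. Qed.

Lemma LpnE p f : Lpn mu p f = ('N[mu]_p%:E[EFin \o (fun x => cabs (f x))])%E.
Proof.
rewrite unlock /Lpn; congr (_ `^ _)%E; apply: eq_integral => x _ /=.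
by rewrite ger0_norm ?cabs_ge0// poweR_EFin.
Qed.

Lemma le_Lpn p f g : 0 <= p -> cmeasurable setT f -> cmeasurable setT g ->
  (forall x, cabs (f x) <= cabs (g x)) -> (Lpn mu p f <= Lpn mu p g)%E.
Proof.
move=> p0 mf mg fg; rewrite /Lpn.
have i0 h : (0 <= \int[mu]_x ((cabs (h x)) `^ p)%:E :> \bar R)%E.
  by apply: integral_ge0 => x _; rewrite lee_fin powR_ge0.
apply: gt0_ler_poweR.
- by rewrite invr_ge0.
- by rewrite in_itv/= leey andbT i0.
- by rewrite in_itv/= leey andbT i0.
apply: ge0_le_integral => //.
- by move=> x _; rewrite lee_fin powR_ge0.
- exact/measurable_EFinP/cmeasurable_cabsX.
- exact/measurable_EFinP/cmeasurable_cabsX.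
- by move=> x _; rewrite lee_fin ge0_ler_powR ?nnegrE ?cabs_ge0.
Qed.

Lemma LpnD p f g : 1 <= p -> cmeasurable setT f -> cmeasurable setT g ->
  (Lpn mu p (fun x => (f x + g x)%R) <= Lpn mu p f + Lpn mu p g)%E.
Proof.
move=> p1 mf mg; have p0 : 0 <= p by rewrite (le_trans _ p1).
have mfg := cmeasurableD mf mg.
(* |f| + |g| dominates |f + g|, and the real Minkowski inequality applies to its two summands. *)
pose F x := cofR (cabs (f x) + cabs (g x)).
have mF : cmeasurable setT F.
  by split; [apply: measurable_funD; exact: cmeasurable_cabs|exact: measurable_cst].
apply: (@le_trans _ _ (Lpn mu p F)).
  apply: le_Lpn => // x; rewrite cabs_cofR ?cabsD//.
  by rewrite addr_ge0 ?cabs_ge0.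
rewrite !LpnE.
have -> : (EFin \o (fun x => cabs (F x))) =
    EFin \o ((fun x => cabs (f x)) \+ (fun x => cabs (g x))).
  apply/funext => x /=; rewrite cabs_cofR//.
  by rewrite addr_ge0 ?cabs_ge0.
by apply: minkowski_EFin => //; exact: cmeasurable_cabs.
Qed.

Lemma Lpn0 p : 0 < p -> Lpn mu p (fun=> 0) = 0%E.
Proof.
move=> p0; rewrite /Lpn integral0_eq ?poweR0r//.
  by rewrite invr_eq0 gt_eqF.
by move=> x _; rewrite cabs0 powR0// gt_eqF.
Qed.

Lemma Lpn_sum (I : Type) (l : seq I) p (h : I -> T -> R[i]) : 1 <= p ->
  (forall i, cmeasurable setT (h i)) ->
  (Lpn mu p (fun x => (\sum_(i <- l) h i x)%R) <= \sum_(i <- l) Lpn mu p (h i))%E.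
Proof.
move=> p1 mh; elim: l => [|i l IHl].
  under eq_fun do rewrite big_nil.
  by rewrite big_nil Lpn0// (lt_le_trans _ p1).
under eq_fun do rewrite big_cons.
rewrite big_cons; apply: le_trans (LpnD p1 (mh i) (cmeasurable_sum l mh)) _.
exact: leeD.
Qed.

(** At each point at most one indicator is nonzero, so the p-th power of the modulus distributes
    over the sum, which is then integrated term by term. *)
Lemma Lpn_disjoint (I : choiceType) (D : set I) p (v : I -> R[i]) (A : I -> set T) :
  0 < p -> finite_set D -> (forall i, D i -> measurable (A i)) ->
  (forall i j, D i -> D j -> i <> j -> A i `&` A j = set0) ->
  Lpn mu p (fun x => \sum_(i \in D) v i * cind (A i) x) =
  ((\sum_(i \in D) cabs (v i) `^ p * msr mu (A i)) `^ p^-1)%:E.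
Proof.
move=> p0 finD mA disjA; rewrite /Lpn -poweR_EFin; congr (_ `^ _)%E.
have pE (x : T) : ((cabs (\sum_(i \in D) v i * cind (A i) x)) `^ p)%:E =
    (\sum_(i <- fset_set D) (cabs (v i) `^ p * (\1_(A i) x))%:E)%E.
  rewrite sumEFin; congr EFin.
  rewrite (@fsum_comp_single _ _ _ _ _ (fun z => cabs z `^ p))//.
  - rewrite fsbig_finite//; apply: eq_big_seq => i _.
    rewrite cabsM powRM ?cabs_ge0// cabs_cind indicE.
    by case: (x \in _); rewrite ?powR1// powR0// gt_eqF.
  - by rewrite cabs0 powR0// gt_eqF.
  - move=> i j Di Dj; rewrite /cind.
    case: asboolP => Ai; last by rewrite mulr0.
    case: asboolP => Aj; last by rewrite mulr0.
    move=> _ _; apply/eqP/negP => /negP/eqP ij.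
    by suff: set0 x by []; rewrite -(disjA i j Di Dj ij).
under eq_integral do rewrite pE.
(* Terms with index outside [D] are set to 0, so that every term of the family is measurable. *)
have -> : (fun x : T => \sum_(i <- fset_set D) (cabs (v i) `^ p * (\1_(A i) x))%:E)%E =
   (fun x => \sum_(i <- fset_set D) if i \in D then (cabs (v i) `^ p * (\1_(A i) x))%:E else 0)%E.
  by apply/funext => x; apply: eq_big_seq => i; rewrite in_fset_set// => ->.
rewrite ge0_integral_sum//; last 2 first.
- move=> i; have [/set_mem Di|_] := boolP (i \in D); last exact: measurable_cst.
  by apply/measurable_EFinP/measurable_funM => //; apply: measurable_indic; exact: mA.
- by move=> i x _; case: ifPn => // _; rewrite lee_fin mulr_ge0 ?powR_ge0.
rewrite fsbig_finite// -sumEFin; apply: eq_big_seq => i.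
rewrite in_fset_set// => /[dup] iD ->; rewrite inE in iD.
under eq_integral do rewrite EFinM.
rewrite ge0_integralZl//; last 2 first.
- by apply/measurable_EFinP; apply: measurable_indic; exact: mA.
- by rewrite lee_fin powR_ge0.
by rewrite integral_indic ?setIT ?EFinM ?fineK ?fin_num_measure//; exact: mA.
Qed.

End ComplexLp.

(** * Geometric sums and Young's inequality for a geometric kernel *)

Lemma sum_geom_le (R : realFieldType) (t : R) n : 0 <= t -> t < 1 ->
  \sum_(k < n) t ^+ k <= (1 - t)^-1.
Proof.
move=> t0 t1; rewrite -[leRHS]mul1r ler_pdivlMr ?subr_gt0// mulrC.
by rewrite -opprB mulNr -subrX1 opprB gerBl exprn_ge0.
Qed.

Section GeometricConvolution.
Context {R : realType}.
Variables (lam : R) (D : nat -> R).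
Hypotheses (lam0 : 0 < lam) (lam1 : lam < 1) (D0 : forall k, 0 <= D k).

Definition geom_conv k := \sum_(i < k.+1) lam ^+ (k - i) * D i.

Lemma geom_conv0 : geom_conv 0 = D 0%N.
Proof. by rewrite /geom_conv big_ord_recl big_ord0 expr0 mul1r addr0. Qed.

(** This recursion lets the bounds below go by induction, without any double sum. *)
Lemma geom_convS k : geom_conv k.+1 = lam * geom_conv k + D k.+1.
Proof.
rewrite /geom_conv big_ord_recr /= subnn expr0 mul1r mulr_sumr; congr (_ + _).
by apply: eq_bigr => i _; rewrite mulrA -exprS subSn// -ltnS.
Qed.

Lemma geom_conv_ge0 k : 0 <= geom_conv k.
Proof. by apply: sumr_ge0 => i _; rewrite mulr_ge0// exprn_ge0// ltW. Qed.

Let lam1_gt0 : 0 < 1 - lam. Proof. by rewrite subr_gt0. Qed.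

(** M / (1 - lam) is the fixed point of x -> lam x + M, so the recursion preserves the bound. *)
Lemma geom_conv_le M k : (forall i, D i <= M) -> geom_conv k <= M / (1 - lam).
Proof.
move=> DM; rewrite ler_pdivlMr//; elim: k => [|k IHk].
  rewrite geom_conv0; apply: le_trans (DM 0%N).
  by rewrite ler_piMr// gerBl ltW.
rewrite geom_convS mulrDl -mulrA.
apply: (@le_trans _ _ (lam * M + M * (1 - lam))); last first.
  by rewrite mulrBr mulr1 mulrC addrCA subrr addr0.
by rewrite lerD// ?ler_pM2l// ler_pM2r.
Qed.

(* Convexity of [x `^ r] applied to
   [geom_conv k.+1 = lam * geom_conv k + (1 - lam) * (D k.+1 / (1 - lam))]. *)
Lemma geom_convX r k : 1 <= r -> geom_conv k.+1 `^ r <=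
  lam * geom_conv k `^ r + (1 - lam) `^ (1 - r) * D k.+1 `^ r.
Proof.
move=> r1; have r0 : 0 <= r by exact: le_trans r1.
have y0 := geom_conv_ge0 k; have z0 : 0 <= D k.+1 / (1 - lam) by rewrite divr_ge0// ltW.
have zE : (1 - lam) * (D k.+1 / (1 - lam)) = D k.+1.
  by rewrite mulrC divfK// gt_eqF.
apply: (@le_trans _ _ (lam * geom_conv k `^ r +
    (1 - lam) * (D k.+1 / (1 - lam)) `^ r)).
  rewrite geom_convS -[in leLHS]zE.
  by apply: (convex_powR r1 (Itv01 (ltW lam0) (ltW lam1))) => //=;
    rewrite inE/= in_itv/= andbT.
rewrite lerD2l powRM ?invr_ge0 ?(ltW lam1_gt0)//.
rewrite -powR_inv1 ?(ltW lam1_gt0)// -powRrM mulN1r mulrCA [leRHS]mulrC ler_wpM2l ?powR_ge0//.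
rewrite powRD; last by rewrite (gt_eqF lam1_gt0) implybT.
by rewrite powRr1 ?(ltW lam1_gt0).
Qed.

(** Summing [geom_convX] bounds S_(n+1) by lam S_n plus a multiple of the sum of the D_k^r. Since
    S_n <= S_(n+1), the first term is absorbed on the left, and (1-lam)^(1-r) / (1-lam) =
    (1-lam)^(-r). *)
Lemma sum_geom_convX r n : 1 <= r ->
  \sum_(k < n) geom_conv k `^ r <= (1 - lam)^-1 `^ r * \sum_(k < n) D k `^ r.
Proof.
move=> r1; case: n => [|n]; first by rewrite !big_ord0 mulr0.
have r0 : 0 <= r by exact: le_trans r1.
pose S n := \sum_(k < n) geom_conv k `^ r.
have Srec k : S k.+1 = S k + geom_conv k `^ r by rewrite /S big_ord_recr.
have SE : S n.+1 <= lam * S n + (1 - lam) `^ (1 - r) * \sum_(k < n.+1) D k `^ r.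
  elim: n => [|n IHn].
    (* At n = 0 only D_0 is left, and (1-lam)^(1-r) >= 1 because r >= 1. *)
    rewrite /S !big_ord_recl !big_ord0 !addr0 mulr0 add0r geom_conv0.
    rewrite ler_peMl ?powR_ge0// -[leLHS](powRr0 (1 - lam)).
    by rewrite ger_powR ?subr_le0// lam1_gt0/= gerBl ltW.
  rewrite Srec [in leRHS]Srec mulrDr big_ord_recr /= mulrDr addrACA.
  by apply: lerD => //; exact: geom_convX.
have {}SE : S n.+1 * (1 - lam) <= (1 - lam) `^ (1 - r) * \sum_(k < n.+1) D k `^ r.
  rewrite mulrBr mulr1 lerBlDl mulrC (le_trans SE)// lerD2r ler_pM2l//.
  by rewrite Srec lerDl powR_ge0.
move: SE; rewrite -ler_pdivlMr// => /le_trans; apply.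
rewrite mulrAC ler_wpM2r ?sumr_ge0// => [i _|]; first exact: powR_ge0.
rewrite -!powR_inv1 ?(ltW lam1_gt0)// -powRD; last by rewrite (gt_eqF lam1_gt0) implybT.
by rewrite -powRrM mulN1r addrAC subrr add0r.
Qed.

End GeometricConvolution.

(** * The outer l^q norm *)

Section MixedNorm.
Context {R : realType}.
Implicit Types (q : \bar R).

Lemma lq_ge0 q (u : nat -> \bar R) : (forall k, (0 <= u k)%E) -> (0 <= lq q u)%E.
Proof.
move=> u0; case: q => [r| |] /=; first exact: poweR_ge0.
  by apply: le_trans (u0 0%N) _; apply: ereal_sup_ubound; exists 0%N.
by apply: le_trans (u0 0%N) _; apply: ereal_sup_ubound; exists 0%N.
Qed.

(** Each term is dominated by the whole l^q norm. The uniform [M] is all that the convergence proof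
    of the sliced expansion uses of the coefficient norm. *)
Lemma lq_bounded q (D : nat -> R) : (1 <= q)%E -> (forall k, 0 <= D k) ->
  (lq q (fun k => (D k)%:E) < +oo)%E -> exists2 M, 0 <= M & forall k, D k <= M.
Proof.
case: q => [r| |//] /=; last first.
  move=> _ D0 supD; have Dsup k : ((D k)%:E <= ereal_sup (range (fun k => (D k)%:E)))%E.
    by apply: ereal_sup_ubound; exists k.
  case: ereal_sup supD Dsup => [M| |] // _ DM; last by have := DM 0%N.
  by exists M => [|k]; rewrite -lee_fin// (le_trans _ (DM 0%N))// lee_fin.
rewrite lee_fin => r1 D0; have r0 : 0 < r by exact: lt_le_trans r1.
move=> /(@lty_poweRy _ _ _ _) => /(_ (invr_neq0 (lt0r_neq0 r0))) sumD.
have Dsum k : ((D k `^ r)%:E <= \sum_(j <oo) (D j)%:E `^ r)%E.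
  rewrite -poweR_EFin; apply: le_trans (nneseries_lim_ge k.+1 _); last first.
    by move=> i _ _; exact: poweR_ge0.
  by rewrite big_nat_recr//= leeDr// sume_ge0// => i _; rewrite lee_fin powR_ge0.
have sum0 : (0 <= \sum_(j <oo) (D j)%:E `^ r)%E.
  by apply: nneseries_ge0 => *; exact: poweR_ge0.
case: (limn _) sumD sum0 Dsum => [M| |]// _; rewrite lee_fin => M0 Dsum.
exists (M `^ r^-1) => [|k]; first exact: powR_ge0.
have := Dsum k; rewrite lee_fin => DM.
rewrite -[leLHS](powRr1 (D0 k)) -(@mulfV _ r) ?gt_eqF// powRrM.
by rewrite ge0_ler_powR ?nnegrE ?powR_ge0 ?invr_ge0// ltW.
Qed.

(** For finite q, [sum_geom_convX] bounds the partial sums uniformly and the bound passes to the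
    limit; for q = +oo, [geom_conv_le] applies with M the supremum. *)
Lemma lq_geom_conv q lam A (D : nat -> R) (u : nat -> \bar R) :
  (1 <= q)%E -> 0 < lam -> lam < 1 -> 0 <= A -> (forall k, 0 <= D k) ->
  (forall k, (0 <= u k)%E) -> (forall k, (u k <= (A * geom_conv lam D k)%:E)%E) ->
  (lq q u <= (A / (1 - lam))%:E * lq q (fun k => (D k)%:E))%E.
Proof.
move=> q1 lam0 lam1 A0 D0 u0 uA.
have c0 : 0 <= A / (1 - lam) by rewrite divr_ge0// subr_ge0 ltW.
case: q q1 => [r| |//] /=; last first.
  move=> _; apply: ge_ereal_sup => _ [k _ <-]; apply: le_trans (uA k) _.
  have Dsup i : ((D i)%:E <= ereal_sup (range (fun k => (D k)%:E)))%E.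
    by apply: ereal_sup_ubound; exists i.
  case: ereal_sup Dsup => [M| |] DM; last by have := DM 0%N.
    rewrite -EFinM lee_fin mulrAC -mulrA ler_wpM2l//.
    by apply: geom_conv_le => // i; rewrite -lee_fin.
  (* With an infinite supremum the right side is +oo, except for A = 0: then 0 * +oo = 0, and the
     left side is 0 as well. *)
  move: A0; rewrite le_eqVlt => /predU1P[<-|A0]; first by rewrite !mul0r mul0e.
  by rewrite gt0_muley ?leey// lte_fin divr_gt0// subr_gt0.
rewrite lee_fin => r1; have r0 : 0 < r by exact: lt_le_trans r1.
have r0' := ltW r0.
have sumD0 : (0 <= \sum_(j <oo) (D j)%:E `^ r)%E.
  by apply: nneseries_ge0 => *; exact: poweR_ge0.
have sumu0 : (0 <= \sum_(j <oo) u j `^ r)%E.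
  by apply: nneseries_ge0 => *; exact: poweR_ge0.
have main : (\sum_(j <oo) u j `^ r <=
    ((A / (1 - lam)) `^ r)%:E * \sum_(j <oo) (D j)%:E `^ r)%E.
  apply: lime_le; first by apply: is_cvg_nneseries => *; exact: poweR_ge0.
  apply: nearW => n.
  apply: (@le_trans _ _ ((A / (1 - lam)) `^ r * \sum_(k < n) D k `^ r)%:E); last first.
    rewrite EFinM lee_wpmul2l ?lee_fin ?powR_ge0//.
    rewrite -sumEFin -(big_mkord xpredT (fun k => (D k `^ r)%:E)).
    under eq_bigr do rewrite -poweR_EFin.
    by apply: nneseries_lim_ge => *; exact: poweR_ge0.
  rewrite big_mkord.
  apply: (@le_trans _ _ (\sum_(k < n) ((A * geom_conv lam D k) `^ r)%:E)%E).
    apply: lee_sum => k _; rewrite -poweR_EFin; apply: gt0_ler_poweR => //.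
      by rewrite in_itv/= u0 leey.
    by rewrite in_itv/= leey lee_fin mulr_ge0// geom_conv_ge0.
  rewrite sumEFin lee_fin; under eq_bigr do rewrite powRM ?geom_conv_ge0//.
  rewrite -mulr_sumr powRM ?invr_ge0 ?subr_ge0 ?(ltW lam1)// -mulrA.
  by rewrite ler_wpM2l ?powR_ge0// sum_geom_convX.
apply: (@le_trans _ _ ((((A / (1 - lam)) `^ r)%:E * \sum_(j <oo) (D j)%:E `^ r) `^ r^-1)%E).
  apply: gt0_ler_poweR; rewrite ?invr_ge0 ?in_itv/= ?leey ?sumu0//.
  by rewrite mule_ge0// lee_fin powR_ge0.
rewrite poweRM ?lee_fin ?powR_ge0// poweR_EFin -powRrM mulfV ?gt_eqF//.
by rewrite powRr1.
Qed.

End MixedNorm.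

(** * Real powers and finite sums *)

Lemma powR_exprn (R : realType) (a x : R) n : 0 <= a ->
  (a `^ x) ^+ n = (a ^+ n) `^ x.
Proof.
move=> a0; rewrite -(powR_mulrn _ (powR_ge0 _ _)) -(powR_mulrn _ a0).
by rewrite -[LHS]powRrM -[RHS]powRrM mulrC.
Qed.

(** Used with r = 1/p, to take the root of an estimate between p-th powers of norms. *)
Lemma le_powR_mul3 (R : realType) (a x y z r : R) : 0 <= r -> 0 <= a ->
  0 <= x -> 0 <= y -> 0 <= z ->
  a <= x * y * z -> a `^ r <= x `^ r * y `^ r * z `^ r.
Proof.
move=> r0 a0 x0 y0 z0 le_a.
rewrite -(powRM r x0 y0) -(powRM r (mulr_ge0 x0 y0) z0).
by apply: ge0_ler_powR => //; rewrite nnegrE ?mulr_ge0.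
Qed.

Section FiniteSums.

Lemma fsum_exchange (I J : choiceType) (V : nmodType) (D : set I) (E : set J)
    (z : I -> J -> V) : finite_set D -> finite_set E ->
  \sum_(i \in D) \sum_(j \in E) z i j = \sum_(j \in E) \sum_(i \in D) z i j.
Proof.
move=> fD fE; rewrite !fsbig_finite//; under eq_bigr do rewrite fsbig_finite//.
by rewrite exchange_big/=; apply: eq_bigr => j _; rewrite fsbig_finite.
Qed.

Lemma fsum_sum_exchange (I : Type) (l : seq I) (J : choiceType) (V : nmodType)
    (E : set J) (z : I -> J -> V) : finite_set E ->
  \sum_(j \in E) \sum_(i <- l) z i j = \sum_(i <- l) \sum_(j \in E) z i j.
Proof.
move=> fE; rewrite fsbig_finite// exchange_big/=.
by apply: eq_bigr => i _; rewrite fsbig_finite.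
Qed.

Lemma ler_fsum (R : numDomainType) (I : choiceType) (D : set I) (u v : I -> R) :
  finite_set D -> (forall i, D i -> u i <= v i) ->
  \sum_(i \in D) u i <= \sum_(i \in D) v i.
Proof.
move=> fD uv; rewrite !fsbig_finite// big_seq [leRHS]big_seq.
by apply: ler_sum => i; rewrite in_fset_set// inE => /uv.
Qed.

Lemma eq_fsum (I : choiceType) (V : nmodType) (D : set I) (u v : I -> V) :
  (forall i, D i -> u i = v i) -> \sum_(i \in D) u i = \sum_(i \in D) v i.
Proof. by move=> uv; apply: eq_fsbigr => i /set_mem/uv. Qed.

Lemma fsum_cind (R : realType) T (D : set (set T)) (x : T) : finite_set D ->
  (forall S S', D S -> D S' -> S <> S' -> S `&` S' = set0) ->
  \sum_(S \in D) (cind S x : R[i]) = cind (\bigcup_(S in D) S) x.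
Proof.
move=> fD disjD; have [[S DS Sx]|nx] := pselect ((\bigcup_(S in D) S) x); last first.
  rewrite cind_out// fsbig1// => S DS; rewrite cind_out// => Sx.
  by apply: nx; exists S.
rewrite (fsbigD1 S)//= fsbig1 ?addr0 => [|S' [DS' S'S]].
  by rewrite /cind !asboolT//; exists S.
rewrite cind_out// => S'x; suff: (S `&` S') x by rewrite disjD// => /esym.
by [].
Qed.

End FiniteSums.

(** * Nesting, levels and measures of the cells of a good grid *)

Section GoodGrid.
Context {R : realType} {d : measure_display} {T : measurableType d}.
Variables (m : probability T R) (P : @gridT d T) (c1 c2 : R).
Hypothesis gridP : good_grid m P c1 c2.

Lemma grid_ratio_gt0 : 0 < c2.
Proof. by case: gridP => -[_ [c10 [c12 _]]] *; exact: lt_trans c12. Qed.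

Lemma grid_ratio_lt1 : c2 < 1.
Proof. by case: gridP => -[_ [_ []]]. Qed.

Lemma grid_finite k : finite_set (P k).
Proof. by case: gridP => -[[]]. Qed.

Lemma grid_measurable k Q : P k Q -> measurable Q.
Proof. by case: gridP => -[[_ gm _ _] _ _ _ _] _ /gm[]. Qed.

Lemma msr_ge0 A : 0 <= msr m A.
Proof. by rewrite fine_ge0. Qed.

Lemma msrE A : measurable A -> (msr m A)%:E = m A.
Proof. by move=> mA; rewrite fineK// fin_num_measure. Qed.

Lemma le_msr A B : measurable A -> measurable B -> A `<=` B -> msr m A <= msr m B.
Proof.
by move=> mA mB AB; rewrite -lee_fin !msrE//; apply: le_measure => //; rewrite inE.
Qed.

Lemma grid_msr_gt0 k Q : P k Q -> 0 < msr m Q.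
Proof.
move=> PQ; rewrite -lte_fin msrE; last exact: grid_measurable PQ.
by case: gridP => -[[_ gm _ _] _ _ _ _] _; have [] := gm _ _ PQ.
Qed.

Lemma grid_nonempty k Q : P k Q -> exists x, Q x.
Proof.
move=> PQ; apply/set0P/eqP => Q0; have := grid_msr_gt0 PQ.
by rewrite Q0 /msr measure0 ltxx.
Qed.

Lemma grid_disjoint k Q Q' : P k Q -> P k Q' -> Q <> Q' -> Q `&` Q' = set0.
Proof. by case: gridP => -[_ _ _ gd _] _; exact: gd. Qed.

Lemma grid_eq k Q Q' x : P k Q -> P k Q' -> Q x -> Q' x -> Q = Q'.
Proof.
move=> PQ PQ' Qx Q'x; apply: contrapT => QQ'.
by suff: set0 x by []; rewrite -(grid_disjoint PQ PQ' QQ').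
Qed.

(** Climb n generations of parents; each one gains a factor [c2] in measure. *)
Lemma grid_ancestor i n S : P (i + n)%N S ->
  exists Q, [/\ P i Q, S `<=` Q & msr m S <= c2 ^+ n * msr m Q].
Proof.
case: gridP => _ [gsub gratio _]; elim: n S => [|n IHn] S PS.
  by exists S; rewrite addn0 in PS; split=> //; rewrite expr0 mul1r.
rewrite addnS in PS; have [S' [PS' SS']] := gsub _ _ PS.
have [Q [PQ S'Q leQ]] := IHn _ PS'; exists Q; split=> //; first exact: subset_trans S'Q.
have /andP[_] := gratio _ _ _ PS PS' SS'.
rewrite ler_pdivrMr ?(grid_msr_gt0 PS')// => /le_trans; apply.
by rewrite exprS -mulrA ler_pM2l// grid_ratio_gt0.
Qed.

(** If k < i, the level-k ancestor of Q meets S, hence equals S; then |Q| <= c2^(i-k) |S| < |S|,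
    against S being inside Q. *)
Lemma grid_sub_level i k Q S : P i Q -> P k S -> S `<=` Q -> (i <= k)%N.
Proof.
move=> PQ PS SQ; rewrite leqNgt; apply/negP => ki.
have [x Sx] := grid_nonempty PS.
(* Writing the exponent as a successor makes the power of [c2] strictly less than 1. *)
have iE : i = (k + (i - k).-1.+1)%N by rewrite prednK ?subn_gt0// subnKC// ltnW.
have [Q' [PQ' QQ' leQ]] : exists Q', [/\ P k Q', Q `<=` Q' &
    msr m Q <= c2 ^+ (i - k).-1.+1 * msr m Q'] by apply: grid_ancestor; rewrite -iE.
have SQ' : S = Q' by apply: (grid_eq PS PQ' Sx); exact/QQ'/SQ.
suff : msr m Q < msr m S.
  by rewrite ltNge le_msr//; [exact: grid_measurable PS|exact: grid_measurable PQ].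
apply: le_lt_trans leQ _; rewrite SQ' gtr_pMl ?(grid_msr_gt0 PQ')//.
by rewrite exprn_ilt1// ?grid_ratio_lt1// ltW// grid_ratio_gt0.
Qed.

Lemma grid_sub_msr i k Q S : P i Q -> P k S -> S `<=` Q ->
  msr m S <= c2 ^+ (k - i) * msr m Q.
Proof.
move=> PQ PS SQ; have ik := grid_sub_level PQ PS SQ.
have [x Sx] := grid_nonempty PS.
have [Q' [PQ' SQ' leS]] : exists Q', [/\ P i Q', S `<=` Q' &
    msr m S <= c2 ^+ (k - i) * msr m Q'] by apply: grid_ancestor; rewrite subnKC.
by rewrite (grid_eq PQ PQ' (SQ _ Sx) (SQ' _ Sx)).
Qed.

(** Coefficients are indexed by sets alone, without a level; this is why a level-by-level definition
    of them is consistent. *)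
Lemma grid_level_uniq i k Q : P i Q -> P k Q -> i = k.
Proof.
move=> PiQ PkQ; apply/eqP; rewrite eqn_leq.
by rewrite (grid_sub_level PiQ PkQ)// (grid_sub_level PkQ PiQ).
Qed.

Lemma grid_msr_le k S : P k S -> msr m S <= c2 ^+ k.
Proof.
move=> PS; have P0 : P 0%N setT by case: gridP => -[_ _ ->].
have := grid_sub_msr P0 PS (@subsetT _ S).
have m1 : msr m setT = 1 by exact: (congr1 fine (probability_setT m)).
by rewrite subn0 m1 mulr1.
Qed.

(** * Level sums and level norms over part of the grid *)

Section SubGrid.
Variable G : @gridT d T.
Hypothesis GP : forall k, G k `<=` P k.
Implicit Types (c : set T -> R[i]).

Lemma subgrid_finite k : finite_set (G k).
Proof. exact: sub_finite_set (@GP k) (grid_finite k). Qed.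

Lemma cmeasurable_level_sum sigma p c k :
  cmeasurable setT (level_sum m G sigma p c k).
Proof.
rewrite /level_sum /atom; under eq_fun do under eq_fsbigr do rewrite mulrA.
apply: cmeasurable_fsum; first exact: subgrid_finite.
by move=> S /GP; exact: grid_measurable.
Qed.

(** Cells of one level are disjoint, and (|S|^(sigma-1/p))^p |S| = |S|^(sigma p). *)
Lemma Lpn_level_sum sigma p c k : 0 < p ->
  Lpn m p (level_sum m G sigma p c k) =
  ((\sum_(S \in G k) cabs (c S) `^ p * msr m S `^ (sigma * p)) `^ p^-1)%:E.
Proof.
move=> p0; rewrite /level_sum /atom.
under [X in Lpn _ _ X]eq_fun do under eq_fsbigr do rewrite mulrA.
rewrite Lpn_disjoint//; last 3 first.
- exact: subgrid_finite.
- by move=> S /GP; exact: grid_measurable.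
- by move=> S S' /GP PS /GP PS'; exact: grid_disjoint PS PS'.
congr (_ `^ _)%:E; apply: eq_fsum => S /GP/grid_msr_gt0 S0.
rewrite cabsM powRM ?cabs_ge0// cabs_cofR ?powR_ge0// -mulrA; congr (_ * _).
rewrite -powRrM -[X in _ * X]powRr1 ?msr_ge0// -powRD ?(gt_eqF S0) ?implybT//.
by congr (_ `^ _); rewrite mulrBl mulVf ?gt_eqF// subrK.
Qed.

Lemma level_norm_Lpn p c k : 0 < p ->
  (level_norm G p c k)%:E = Lpn m p (level_sum m G 0 p c k).
Proof.
move=> p0; rewrite Lpn_level_sum//; congr (_ `^ _)%:E.
by apply: eq_fsum => S _; rewrite mul0r powRr0 mulr1.
Qed.

Lemma level_norm_ge0 p c k : 0 <= level_norm G p c k.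
Proof. exact: powR_ge0. Qed.

Lemma level_sum_sum sigma p n (b : nat -> set T -> R[i]) k x :
  level_sum m G sigma p (fun S => \sum_(i < n) b i S) k x =
  \sum_(i < n) level_sum m G sigma p (b i) k x.
Proof.
rewrite /level_sum; under eq_fsbigr do rewrite mulr_suml.
by rewrite fsum_sum_exchange//; exact: subgrid_finite.
Qed.

(* The level norm is the L^p norm of the level sum with exponent 0, so the
   triangle inequality in l^p follows from the one in L^p. *)
Lemma level_norm_sum p n (b : nat -> set T -> R[i]) k : 1 <= p ->
  level_norm G p (fun S => \sum_(i < n) b i S) k <=
  \sum_(i < n) level_norm G p (b i) k.
Proof.
move=> p1; have p0 : 0 < p by exact: lt_le_trans p1.
have sumE : (\sum_(i < n) level_norm G p (b i) k)%:E =
    (\sum_(i < n) Lpn m p (level_sum m G 0 p (b i) k))%E.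
  rewrite -[LHS]sumEFin; apply: eq_bigr => i _; exact: level_norm_Lpn.
rewrite -lee_fin sumE (level_norm_Lpn _ _ p0).
have -> : level_sum m G 0 p (fun S => \sum_(i < n) b i S) k =
    (fun x => \sum_(i < n) level_sum m G 0 p (b i) k x).
  by apply/funext => x; exact: level_sum_sum.
apply: (@Lpn_sum _ _ _ _ _ _ _ (fun i : 'I_n => level_sum m G 0 p (b i) k)) => // i.
exact: cmeasurable_level_sum.
Qed.

Lemma eq_level_norm p c c' k : (forall S, G k S -> c S = c' S) ->
  level_norm G p c k = level_norm G p c' k.
Proof.
move=> cc'; have E : \sum_(S \in G k) cabs (c S) `^ p = \sum_(S \in G k) cabs (c' S) `^ p.
  by apply: eq_fsum => S /cc' ->.
exact (congr1 (fun y => y `^ p^-1) E).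
Qed.

Lemma eq_level_sum sigma p c c' k : (forall S, G k S -> c S = c' S) ->
  level_sum m G sigma p c k = level_sum m G sigma p c' k.
Proof. by move=> cc'; apply/funext => x; apply: eq_fsum => S /cc' ->. Qed.

(** Level-k cells have measure at most c2^k. With sigma = s > 0 this decay makes level sums with
    bounded level norms summable in L^p. *)
Lemma Lpn_level_sum_le sigma p c k : 0 < p -> 0 <= sigma ->
  (Lpn m p (level_sum m G sigma p c k) <=
   ((c2 `^ sigma) ^+ k * level_norm G p c k)%:E)%E.
Proof.
move=> p0 sigma0; rewrite Lpn_level_sum// lee_fin.
have c20 := grid_ratio_gt0.
have -> : (c2 `^ sigma) ^+ k = ((c2 ^+ k) `^ (sigma * p)) `^ p^-1.
  by rewrite -[RHS]powRrM (mulfK (lt0r_neq0 p0)) powR_exprn// ltW.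
have sum0 : 0 <= \sum_(S \in G k) cabs (c S) `^ p.
  by apply: fsumr_ge0 => S _; exact: powR_ge0.
rewrite -powRM ?powR_ge0// ge0_ler_powR ?nnegrE ?invr_ge0 ?(ltW p0) ?mulr_ge0 ?powR_ge0//.
  by apply: fsumr_ge0 => S _; rewrite mulr_ge0 ?powR_ge0.
rewrite mulr_fsumr; apply: ler_fsum; first exact: subgrid_finite.
move=> S /GP PS; rewrite mulrC ler_wpM2r ?powR_ge0//.
rewrite ge0_ler_powR ?nnegrE ?mulr_ge0 ?(ltW p0) ?exprn_ge0 ?msr_ge0 ?(ltW c20)//.
exact: grid_msr_le.
Qed.

End SubGrid.

End GoodGrid.

(** * Slicing a representation along one domain [Om], with [K] as C_rp *)

Section Slicing.
Context {R : realType} {d : measure_display} {T : measurableType d}.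
Variables (m : probability T R) (P : @gridT d T) (c1 c2 s beta p : R).
Hypothesis gridP : good_grid m P c1 c2.
Hypotheses (p1 : 1 <= p) (s0 : 0 < s) (sbeta : s < beta).
Variables (Om : set T) (F : set T -> @gridT d T) (K : R).
Hypotheses (mOm : measurable Om) (K0 : 0 < K).
Hypothesis decompF : forall i Q, P i Q -> decomp P (Q `&` Om) (F Q).
Hypothesis sumF : forall i Q k, P i Q ->
  \sum_(S \in F Q k) msr m S `^ (1 - beta * p) <= K * msr m Q `^ (1 - beta * p).
Variable dc : set T -> R[i].

Let G := sub_grid P Om.
Let lam := c2 `^ (beta - s).

Let p0 : 0 < p. Proof. exact: lt_le_trans p1. Qed.
Let p_ge0 : 0 <= p. Proof. exact: ltW. Qed.
Let c20 : 0 < c2. Proof. exact: grid_ratio_gt0 gridP. Qed.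
Let beta0 : 0 < beta. Proof. exact: lt_trans sbeta. Qed.
Let GP k : G k `<=` P k. Proof. by move=> Q []. Qed.

Lemma powR_ratio_lt1 x : 0 < x -> 0 < c2 `^ x < 1.
Proof.
move=> x0; rewrite powR_gt0//=.
have := @gt0_ltr_powR R x x0 c2 1; rewrite !nnegrE (ltW c20) ler01 powR1.
by apply=> //; exact: grid_ratio_lt1 gridP.
Qed.

Let lam0 : 0 < lam.
Proof. by have /andP[] : 0 < lam < 1 by apply: powR_ratio_lt1; rewrite subr_gt0. Qed.
Let lam1 : lam < 1.
Proof. by have /andP[] : 0 < lam < 1 by apply: powR_ratio_lt1; rewrite subr_gt0. Qed.

Lemma decomp_sub i Q k S : P i Q -> F Q k S -> [/\ P k S, S `<=` Q & S `<=` Om].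
Proof.
move=> PQ FS; have [FP _ bigF] := decompF PQ.
have SQ : S `<=` Q `&` Om by rewrite -bigF => x Sx; exists k => //; exists S.
by split; [exact: FP|move=> x /SQ[]|move=> x /SQ[]].
Qed.

Definition pieces Q : set (set T) := in_grid (F Q).

(** The index of a piece in [F Q] is its grid level. A sum over [F Q k] thus becomes a conditional
    sum over [G k], whose index set is independent of Q, and can be exchanged with the sum over
    Q. *)
Lemma decomp_levelE i Q k : P i Q -> F Q k = G k `&` pieces Q.
Proof.
move=> PQ; apply/seteqP; split=> S.
  by move=> FS; have [PS _ SOm] := decomp_sub PQ FS; split=> //; exists k.
move=> [[PS _] [j FS]]; have [PjS _ _] := decomp_sub PQ FS.
by rewrite (grid_level_uniq gridP PS PjS).
Qed.

Lemma decomp_finite i Q k : P i Q -> finite_set (F Q k).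
Proof.
by move=> PQ; apply: sub_finite_set (grid_finite gridP k) => S /(decomp_sub PQ)[].
Qed.

Lemma decomp_disjoint i Q j k S S' x : P i Q -> F Q j S -> F Q k S' ->
  S x -> S' x -> j = k /\ S = S'.
Proof.
move=> PQ FS FS' Sx S'x; apply: contrapT => nE.
have [_ disjF _] := decompF PQ.
suff: set0 x by []; rewrite -(disjF j k S S')//.
have [jk|] := pselect (j = k); last by left.
by right=> SS'; apply: nE.
Qed.

(* Interpolates between the strong regularity exponent and any larger one,
   gaining a geometric factor from the shrinking of the cells. *)
Lemma sum_decomp_powR tau i Q k : 0 <= tau -> P i Q ->
  \sum_(S \in F Q k) msr m S `^ (1 - beta * p + tau) <=
  K * (c2 `^ tau) ^+ (k - i) * msr m Q `^ (1 - beta * p + tau).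
Proof.
move=> tau0 PQ; have Q0 := grid_msr_gt0 gridP PQ.
rewrite [msr m Q `^ _]powRD ?(gt_eqF Q0) ?implybT//.
apply: (@le_trans _ _ (\sum_(S \in F Q k) msr m S `^ (1 - beta * p) *
    ((c2 `^ tau) ^+ (k - i) * msr m Q `^ tau))).
  apply: ler_fsum => [|S FS]; first exact: decomp_finite PQ.
  have [PS SQ _] := decomp_sub PQ FS; have S0 := grid_msr_gt0 gridP PS.
  rewrite powRD ?(gt_eqF S0) ?implybT// ler_wpM2l ?powR_ge0//.
  rewrite (powR_exprn _ _ (ltW c20)) -powRM ?exprn_ge0 ?(ltW c20) ?(ltW Q0)//.
  rewrite ge0_ler_powR ?nnegrE ?mulr_ge0 ?exprn_ge0 ?(ltW c20) ?(ltW Q0) ?(ltW S0)//.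
  exact: (grid_sub_msr gridP).
rewrite -mulr_fsuml [leRHS]mulrACA.
apply: ler_wpM2r; last exact: sumF PQ.
by rewrite mulr_ge0 ?exprn_ge0 ?powR_ge0.
Qed.

(** The constant value of d_Q a_Q on Q. *)
Definition cell_weight Q : R[i] := dc Q * cofR (msr m Q `^ (s - p^-1)).

(* Expanding [d_Q a_Q 1_Om] over the pieces of [Q `&` Om], a piece [S] of [Q]
   receives the coefficient [d_Q |Q|^(s-1/p) |S|^(1/p-s)]. *)
Definition slice_coef_level i S : R[i] :=
  cofR (msr m S `^ (p^-1 - s)) *
  \sum_(Q \in P i) if S \in pieces Q then cell_weight Q else 0.

(* [xget] recovers the level of [S], which is unique in a good grid. *)
Definition slice_coef S : R[i] :=
  \sum_(i < (xget 0%N [set k | P k S]).+1) slice_coef_level i S.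

Lemma slice_coefE k S : P k S ->
  slice_coef S = \sum_(i < k.+1) slice_coef_level i S.
Proof.
move=> PS; rewrite /slice_coef; case: xgetP => [j _ /= PjS|/(_ k)//].
by rewrite (grid_level_uniq gridP PjS PS).
Qed.

Lemma slice_coef_ge0 k S : (forall k Q, P k Q -> 0 <= dc Q) -> P k S ->
  0 <= slice_coef S.
Proof.
move=> dc0 PS; rewrite (slice_coefE PS); apply: sumr_ge0 => i _.
rewrite mulr_ge0 ?cofR_ge0 ?powR_ge0//; apply: fsumr_ge0 => Q PQ.
by case: ifP => // _; rewrite mulr_ge0 ?cofR_ge0 ?powR_ge0// (dc0 _ _ PQ).
Qed.

(** A cell S lies in at most one level-i cell, so p-th powers pass inside the sum over Q. After
    exchanging sums, each Q carries |d_Q|^p |Q|^(sp-1) times the sum of |S|^(1-sp) over its level-k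
    pieces. As 1-sp = (1-beta p) + (beta-s)p, [sum_decomp_powR] with tau = (beta-s)p applies, and
    the powers of |Q| cancel. *)
Lemma slice_level_norm i k :
  level_norm G p (slice_coef_level i) k <=
  K `^ p^-1 * lam ^+ (k - i) * level_norm P p dc i.
Proof.
have lamE : lam ^+ (k - i) = (((c2 `^ ((beta - s) * p)) ^+ (k - i))) `^ p^-1.
  by rewrite /lam !(powR_exprn _ _ (ltW c20)) -[RHS]powRrM (mulfK (lt0r_neq0 p0)).
rewrite lamE; apply: le_powR_mul3.
- by rewrite invr_ge0.
- by apply: fsumr_ge0 => S _; exact: powR_ge0.
- exact: ltW.
- by rewrite exprn_ge0// powR_ge0.
- by apply: fsumr_ge0 => Q _; exact: powR_ge0.
have lhsE : \sum_(S \in G k) cabs (slice_coef_level i S) `^ p =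
    \sum_(S \in G k) \sum_(Q \in P i) if S \in pieces Q then
      cabs (dc Q) `^ p * msr m Q `^ (s * p - 1) * msr m S `^ (1 - s * p) else 0.
  apply: eq_fsum => S [PS _].
  rewrite /slice_coef_level cabsM powRM ?cabs_ge0// cabs_cofR ?powR_ge0//.
  rewrite -powRrM mulrBl mulVf ?gt_eqF//.
  rewrite (@fsum_comp_single _ _ _ _ _ (fun z => cabs z `^ p)); last 3 first.
  - exact: grid_finite gridP i.
  - by rewrite cabs0 powR0// gt_eqF.
  (* Two level-i cells having the nonempty set S as a piece meet, hence coincide. *)
  - move=> Q Q' PQ PQ'.
    case: ifPn => [/set_mem[j FS] _|//]; case: ifPn => [/set_mem[j' FS'] _|//].
    have [x Sx] := grid_nonempty gridP PS.
    have [_ SQ _] := decomp_sub PQ FS; have [_ SQ' _] := decomp_sub PQ' FS'.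
    exact: (grid_eq gridP PQ PQ' (SQ _ Sx) (SQ' _ Sx)).
  rewrite mulr_fsumr; apply: eq_fsum => Q PQ.
  case: ifPn => _; last by rewrite cabs0 powR0 ?mulr0// gt_eqF.
  rewrite cabsM powRM ?cabs_ge0// cabs_cofR ?powR_ge0// -powRrM mulrBl mulVf ?gt_eqF//.
  by rewrite mulrC.
rewrite [leLHS]lhsE [leLHS]fsum_exchange; last 2 first.
- exact: subgrid_finite gridP _ GP k.
- exact: grid_finite gridP i.
rewrite mulr_fsumr; apply: ler_fsum => [|Q PQ]; first exact: grid_finite gridP i.
rewrite -fsbig_mkcondr -(decomp_levelE k PQ) -mulr_fsumr.
have Q0 := grid_msr_gt0 gridP PQ.
have sE : 1 - s * p = 1 - beta * p + (beta - s) * p.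
  by rewrite mulrBl addrA subrK.
have := @sum_decomp_powR ((beta - s) * p) i Q k _ PQ.
rewrite -sE mulr_ge0 ?subr_ge0 ?(ltW sbeta)// => /(_ isT) sumS.
have leQ : msr m Q `^ (s * p - 1) * (\sum_(S \in F Q k) msr m S `^ (1 - s * p)) <=
    K * (c2 `^ ((beta - s) * p)) ^+ (k - i).
  apply: le_trans (ler_wpM2l (powR_ge0 _ _) sumS) _.
  rewrite mulrCA -powRD ?(gt_eqF Q0) ?implybT//.
  by rewrite addrA subrK subrr powRr0 mulr1.
rewrite -mulrA [leRHS]mulrC; apply: ler_wpM2l leQ; exact: powR_ge0.
Qed.

(** Split the coefficient by the level i <= k of the parent cell and use the triangle inequality in
    l^p. *)
Lemma slice_norm k : level_norm G p slice_coef k <=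
  K `^ p^-1 * geom_conv lam (level_norm P p dc) k.
Proof.
rewrite (@eq_level_norm _ _ _ _ _ _
    (fun S => \sum_(i < k.+1) slice_coef_level i S)); last first.
  by move=> S [PS _]; exact: slice_coefE.
apply: le_trans (level_norm_sum gridP GP _ _ _ p1) _.
rewrite /geom_conv mulr_sumr; apply: ler_sum => i _.
by rewrite mulrA; exact: slice_level_norm.
Qed.

(** * Pieces by level and the remainder of the truncated expansion *)

Definition level_part Q k := \bigcup_(S in F Q k) S.

Definition tail_part Q n := \bigcup_(k in [set k | (n <= k)%N]) level_part Q k.

(** The factor |S|^(1/p-s) of the coefficient cancels the normalization of the atom, so grouping by
    Q leaves bare indicators of pieces. *)
Lemma level_sum_slice i k x :
  level_sum m G s p (slice_coef_level i) k x =
  \sum_(Q \in P i) cell_weight Q * cind (level_part Q k) x.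
Proof.
have lhsE : level_sum m G s p (slice_coef_level i) k x = \sum_(S \in G k)
    \sum_(Q \in P i) if S \in pieces Q then cell_weight Q * cind S x else 0.
  apply: eq_fsum => S [PS _]; have S0 := grid_msr_gt0 gridP PS.
  rewrite /slice_coef_level /atom mulrACA -cofRM -powRD ?(gt_eqF S0) ?implybT//.
  rewrite addrA subrK subrr powRr0 cofR1 mul1r mulr_fsuml.
  by apply: eq_fsum => Q _; case: ifP => _ //; rewrite mul0r.
rewrite lhsE fsum_exchange; last 2 first.
- exact: subgrid_finite gridP _ GP k.
- exact: grid_finite gridP i.
apply: eq_fsum => Q PQ.
rewrite -fsbig_mkcondr -(decomp_levelE k PQ) -mulr_fsumr; congr (_ * _).
rewrite fsum_cind//; first exact: decomp_finite PQ.
move=> S S' /(decomp_sub PQ)[PS _ _] /(decomp_sub PQ)[PS' _ _].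
exact: (grid_disjoint gridP PS PS').
Qed.

Lemma level_part_eq0 i Q k : P i Q -> (k < i)%N -> level_part Q k = set0.
Proof.
move=> PQ ki; rewrite /level_part; apply: bigcup0 => S FS.
have [PS SQ _] := decomp_sub PQ FS.
by move: ki; rewrite ltnNge (grid_sub_level gridP PQ PS SQ).
Qed.

Lemma tail_part0 i Q : P i Q -> tail_part Q 0 = Q `&` Om.
Proof.
move=> PQ; have [_ _ <-] := decompF PQ.
by apply/seteqP; split=> x [k _ xk]; exists k.
Qed.

Lemma tail_part_sub i Q n : P i Q -> tail_part Q n `<=` Q.
Proof. by move=> PQ x [k _ [S FS Sx]]; have [_ + _] := decomp_sub PQ FS; apply. Qed.

Lemma cind_tail_part i Q n x : P i Q ->
  cind (tail_part Q n) x = cind (level_part Q n) x + cind (tail_part Q n.+1) x :> R[i].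
Proof.
move=> PQ; rewrite -cindU.
  congr (cind _ x); apply/seteqP; split=> y.
    move=> [k /= nk yk]; move: nk; rewrite leq_eqVlt => /predU1P[->|nk]; first by left.
    by right; exists k.
  move=> [yn|[k /= nk yk]]; first by exists n => /=.
  by exists k => //=; exact: ltnW.
apply/seteqP; split=> // y [[S FS Sy] [k /= nk [S' FS' S'y]]].
have [kn _] := decomp_disjoint PQ FS FS' Sy S'y.
by rewrite kn ltnn in nk.
Qed.

Lemma cind_decomp i Q n x : P i Q ->
  cind (Q `&` Om) x =
  \sum_(k < n) cind (level_part Q k) x + cind (tail_part Q n) x :> R[i].
Proof.
move=> PQ; elim: n => [|n ->]; first by rewrite big_ord0 add0r (tail_part0 PQ).
by rewrite big_ord_recr /= -addrA (cind_tail_part n x PQ).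
Qed.

(** Cut each cell of level below n by [cind_decomp] at n: its pieces of level below n make up the
    new partial sum, and the tails are left over. *)
Lemma slice_remainder n x :
  (\sum_(i < n) level_sum m P s p dc i x) * cind Om x -
    \sum_(k < n) level_sum m G s p slice_coef k x =
  \sum_(i < n) \sum_(Q \in P i) cell_weight Q * cind (tail_part Q n) x.
Proof.
apply/eqP; rewrite subr_eq addrC; apply/eqP.
have -> : \sum_(k < n) level_sum m G s p slice_coef k x =
    \sum_(k < n) \sum_(i < n) \sum_(Q \in P i) cell_weight Q * cind (level_part Q k) x.
  apply: eq_bigr => k _.
  rewrite (@eq_level_sum _ _ _ m G s p _
    (fun S => \sum_(i < k.+1) slice_coef_level i S)); last first.
    by move=> S [PS _]; exact: slice_coefE.
  rewrite (level_sum_sum gridP GP).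
  rewrite (eq_bigr (fun i : 'I__ =>
    \sum_(Q \in P i) cell_weight Q * cind (level_part Q k) x)); last first.
    by move=> i _; exact: level_sum_slice.
  (* The range i <= k is extended to i < n: a cell of level i > k has no piece of level k, so the
     added terms vanish. *)
  rewrite (big_ord_widen n (fun i =>
    \sum_(Q \in P i) cell_weight Q * cind (level_part Q k) x))//.
  rewrite [RHS](bigID (fun i : 'I_n => (i < k.+1)%N)) /= [X in _ + X]big1 ?addr0//.
  move=> i; rewrite -leqNgt => ki; apply: fsbig1 => Q PQ.
  by rewrite (level_part_eq0 PQ ki) cind_out ?mulr0.
rewrite exchange_big -big_split /= mulr_suml; apply: eq_bigr => i _.
rewrite -fsum_sum_exchange; last exact: grid_finite gridP i.
rewrite -fsbig_split; last exact: grid_finite gridP i.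
rewrite /level_sum mulr_fsuml; apply: eq_fsum => Q PQ.
rewrite /atom /= -mulr_sumr -mulrDr -(cind_decomp n x PQ) cindI.
by rewrite /cell_weight !mulrA.
Qed.

Lemma measurable_level_part i Q k : P i Q -> measurable (level_part Q k).
Proof.
move=> PQ; apply: fin_bigcup_measurable; first exact: decomp_finite PQ.
by move=> S /(decomp_sub PQ)[+ _ _]; exact: grid_measurable gridP _ _.
Qed.

Lemma measurable_tail_part i Q n : P i Q -> measurable (tail_part Q n).
Proof. by move=> PQ; apply: bigcup_measurable => k _; exact: measurable_level_part PQ. Qed.

Let theta := c2 `^ (beta * p).

Let theta0 : 0 < theta.
Proof. by have /andP[] : 0 < theta < 1 by apply: powR_ratio_lt1; rewrite mulr_gt0. Qed.
Let theta1 : theta < 1.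
Proof. by have /andP[] : 0 < theta < 1 by apply: powR_ratio_lt1; rewrite mulr_gt0. Qed.

(** Take tau = beta p in [sum_decomp_powR]: the exponent becomes 1, and the pieces are disjoint. *)
Lemma msr_level_part i Q k : P i Q ->
  msr m (level_part Q k) <= K * theta ^+ (k - i) * msr m Q.
Proof.
move=> PQ.
have betap0 : 0 <= beta * p by rewrite mulr_ge0 ?(ltW beta0).
have := sum_decomp_powR k betap0 PQ; rewrite subrK (powRr1 (msr_ge0 _ _)).
move=> /(le_trans _); apply.
rewrite le_eqVlt; apply/orP; left; apply/eqP.
rewrite /msr /level_part measure_fin_bigcup; last 3 first.
- exact: decomp_finite PQ.
- by move=> S S' /= FS FS' [x [Sx S'x]]; have [] := decomp_disjoint PQ FS FS' Sx S'x.
- by move=> S /(decomp_sub PQ)[+ _ _]; exact: grid_measurable gridP _ _.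
rewrite !fsbig_finite; [|exact: decomp_finite PQ..].
rewrite (eq_big_seq (fun S => (msr m S `^ 1)%:E)) ?sumEFin// => S.
rewrite in_fset_set; last exact: decomp_finite PQ.
move=> /set_mem/(decomp_sub PQ)[/(grid_measurable gridP) mS _ _].
by rewrite (powRr1 (msr_ge0 _ _)) msrE.
Qed.

(** Sum [msr_level_part] over the levels n + k; as i <= n, the power of [theta] splits off the
    geometric series in k. *)
Lemma msr_tail_part i Q n : P i Q -> (i <= n)%N ->
  msr m (tail_part Q n) <= K / (1 - theta) * theta ^+ (n - i) * msr m Q.
Proof.
move=> PQ ni; have mT := measurable_tail_part n PQ.
rewrite -lee_fin (msrE _ mT).
have subT : tail_part Q n `<=` \bigcup_k level_part Q (n + k).
  by move=> x [k /= nk xk]; exists (k - n)%N => //; rewrite subnKC.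
apply: le_trans (measure_sigma_subadditive m _ mT subT) _.
  by move=> k; exact: measurable_level_part PQ.
apply: lime_le; first by apply: is_cvg_nneseries => *; exact: measure_ge0.
apply: nearW => N; rewrite big_mkord.
rewrite (eq_bigr (fun k : 'I_N => (msr m (level_part Q (n + k)))%:E)); last first.
  by move=> k _; rewrite msrE//; exact: measurable_level_part PQ.
rewrite sumEFin lee_fin.
apply: (@le_trans _ _ (\sum_(k < N) K * theta ^+ (n - i) * msr m Q * theta ^+ k)).
  apply: ler_sum => k _; apply: le_trans (msr_level_part (n + k) PQ) _.
  by rewrite -addnBAC// exprD [in leLHS]mulrA mulrAC.
rewrite -mulr_sumr.
have -> : K / (1 - theta) * theta ^+ (n - i) * msr m Q =
    K * theta ^+ (n - i) * msr m Q * (1 - theta)^-1.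
  by rewrite -!mulrA; congr (_ * _); rewrite mulrC -!mulrA.
apply: ler_wpM2l.
  by rewrite !mulr_ge0 ?exprn_ge0 ?msr_ge0 ?(ltW K0) ?(ltW theta0).
exact: sum_geom_le (ltW theta0) theta1.
Qed.

(** Tails of distinct level-i cells are disjoint, so the norm is explicit; [msr_tail_part] and |Q|
    <= c2^i then bound it. *)
Lemma Lpn_tail_part i n : (i <= n)%N ->
  (Lpn m p (fun x => (\sum_(Q \in P i) cell_weight Q * cind (tail_part Q n) x)%R) <=
  ((K / (1 - theta)) `^ p^-1 * ((c2 `^ s) ^+ n * lam ^+ (n - i)) *
   level_norm P p dc i)%:E)%E.
Proof.
move=> ni; have Kt0 : 0 <= K / (1 - theta).
  by rewrite divr_ge0 ?subr_ge0// ltW.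
rewrite Lpn_disjoint//; last 3 first.
- exact: grid_finite gridP i.
- by move=> Q PQ; exact: measurable_tail_part PQ.
- move=> Q Q' PQ PQ' QQ'; apply/seteqP; split=> // x [Qx Q'x].
  by case: QQ'; apply: (grid_eq gridP PQ PQ' (tail_part_sub PQ Qx) (tail_part_sub PQ' Q'x)).
rewrite lee_fin.
(* Since s i + beta (n-i) = s n + (beta-s)(n-i), the bound is a decay in n alone times a term of the
   convolution with [lam]. *)
have -> : (c2 `^ s) ^+ n * lam ^+ (n - i) =
    (theta ^+ (n - i) * (c2 ^+ i) `^ (s * p)) `^ p^-1.
  have pw j : 0 <= c2 ^+ j by rewrite exprn_ge0// ltW.
  have E1 : (theta ^+ (n - i)) `^ p^-1 = (c2 ^+ (n - i)) `^ beta.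
    by rewrite /theta (powR_exprn _ _ (ltW c20)) -[LHS]powRrM (mulfK (lt0r_neq0 p0)).
  have E2 : ((c2 ^+ i) `^ (s * p)) `^ p^-1 = (c2 ^+ i) `^ s.
    by rewrite -[LHS]powRrM (mulfK (lt0r_neq0 p0)).
  rewrite (powRM _ (exprn_ge0 _ (ltW theta0)) (powR_ge0 _ _)) E1 E2.
  rewrite /lam (powR_exprn s _ (ltW c20)) (powR_exprn _ _ (ltW c20)).
  rewrite -{1}(subnK ni) exprD (powRM _ (pw _) (pw _)) mulrAC -powRD; last first.
    by rewrite expf_eq0 (gt_eqF c20) andbF implybT.
  by rewrite addrCA subrr addr0.
apply: le_powR_mul3 => //.
- by rewrite invr_ge0.
- by apply: fsumr_ge0 => Q _; rewrite mulr_ge0 ?powR_ge0 ?msr_ge0.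
- by rewrite mulr_ge0 ?exprn_ge0 ?powR_ge0.
- by apply: fsumr_ge0 => Q _; exact: powR_ge0.
rewrite [leRHS]mulr_fsumr; apply: ler_fsum => [|Q PQ]; first exact: grid_finite gridP i.
have Q0 := grid_msr_gt0 gridP PQ.
rewrite /cell_weight cabsM (powRM _ (cabs_ge0 _) (cabs_ge0 _)).
rewrite (cabs_cofR (powR_ge0 _ _)) -[X in _ * X * _]powRrM mulrBl mulVf ?gt_eqF//.
rewrite -mulrA [leRHS]mulrC; apply: ler_wpM2l; first exact: powR_ge0.
apply: le_trans (ler_wpM2l (powR_ge0 _ _) (msr_tail_part PQ ni)) _.
rewrite [leLHS]mulrCA [leRHS]mulrA; apply: ler_wpM2l.
  by rewrite mulr_ge0// exprn_ge0// ltW.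
rewrite -[X in _ * X](powRr1 (ltW Q0)) -powRD ?(gt_eqF Q0) ?implybT// subrK.
have pw : 0 <= c2 ^+ i by rewrite exprn_ge0// ltW.
apply: ge0_ler_powR; rewrite ?nnegrE ?(ltW Q0)//; last exact: grid_msr_le gridP _ _ PQ.
by rewrite mulr_ge0 ?(ltW s0).
Qed.

Lemma slice_coef_norm q : (1 <= q)%E ->
  (coef_norm G p q slice_coef <=
   (K `^ p^-1 / (1 - lam))%:E * coef_norm P p q dc)%E.
Proof.
move=> q1; apply: lq_geom_conv => //; first exact: powR_ge0.
- by move=> k; exact: level_norm_ge0.
- by move=> k; rewrite lee_fin level_norm_ge0.
- by move=> k; rewrite lee_fin slice_norm.
Qed.

(** Integrability follows from |f 1_Om| <= |f|, and summability from bounded level norms and the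
    factor c2^(s k). The error at n is the old error cut to [Om] plus the tails, and both tend to 0
    in L^p. *)
Lemma slice_besov_rep q f : (1 <= q)%E -> besov_rep m P s p q f dc ->
  besov_rep m G s p q (fun x => f x * cind Om x) slice_coef.
Proof.
move=> q1 [[mf intf] _ dcq cvgf].
have mO := cmeasurable_cind (R := R) mOm.
have mfO := cmeasurableM mf mO.
have [M M0 DM] := lq_bounded q1 (level_norm_ge0 P p dc) dcq.
have [mu0 mu1] : 0 < c2 `^ s /\ c2 `^ s < 1 by apply/andP; exact: powR_ratio_lt1.
have convM k : geom_conv lam (level_norm P p dc) k <= M / (1 - lam).
  by apply: geom_conv_le => //; exact: level_norm_ge0.
have Mlam0 : 0 <= M / (1 - lam) by rewrite divr_ge0// subr_ge0 ltW.
have le_cind z x : cabs (z * cind Om x) <= cabs z.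
  rewrite cabsM cabs_cind indicE.
  by case: (_ \in _); rewrite ?mulr1// mulr0 cabs_ge0.
split.
- split; first exact: mfO.
  apply: le_lt_trans intf; apply: ge0_le_integral => //.
  + by move=> x _; rewrite lee_fin powR_ge0.
  + exact/measurable_EFinP/cmeasurable_cabsX.
  + exact/measurable_EFinP/cmeasurable_cabsX.
  + by move=> x _; rewrite lee_fin ge0_ler_powR ?nnegrE ?cabs_ge0.
- apply: (@le_lt_trans _ _ ((1 - c2 `^ s)^-1 * (K `^ p^-1 * (M / (1 - lam))))%:E);
    last exact: ltry.
  apply: lime_le; first by apply: is_cvg_nneseries => *; exact: Lpn_ge0.
  apply: nearW => n; rewrite big_mkord.
  apply: (@le_trans _ _ (\sum_(k < n)
      ((c2 `^ s) ^+ k * (K `^ p^-1 * (M / (1 - lam))))%:E)%E).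
    apply: lee_sum => k _.
    apply: le_trans (Lpn_level_sum_le gridP GP _ _ p0 (ltW s0)) _.
    rewrite lee_fin; apply: ler_wpM2l; first by rewrite exprn_ge0// ltW.
    by apply: le_trans (slice_norm k) _; rewrite ler_wpM2l// powR_ge0.
  rewrite sumEFin lee_fin -mulr_suml; apply: ler_wpM2r.
    by rewrite mulr_ge0// powR_ge0.
  exact: sum_geom_le (ltW mu0) mu1.
- apply: le_lt_trans (slice_coef_norm q1) _.
  by rewrite lte_mul_pinfty// lee_fin divr_ge0 ?powR_ge0// subr_ge0 ltW.
- pose B := (K / (1 - theta)) `^ p^-1 * (M / (1 - lam)).
  pose rem n x := f x - \sum_(i < n) level_sum m P s p dc i x.
  have mrem n : cmeasurable setT (rem n).
    apply: cmeasurableB => //; apply: cmeasurable_sum => i.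
    exact: cmeasurable_level_sum gridP _ (fun k => @subset_refl _ _) _ _ _ _.
  apply: (@squeeze_cvge _ _ _ _ (cst 0%E) _
      (fun n => Lpn m p (rem n) + (B * (c2 `^ s) ^+ n)%:E)%E); last 2 first.
  + exact: cvg_cst.
  + rewrite -[X in _ --> X]adde0; apply: cvgeD => //.
    apply: cvg_EFin; first exact: nearW.
    rewrite -[X in _ --> X](mulr0 B); apply: cvgMr.
    by apply: cvg_expr; rewrite ger0_norm// ltW.
  + apply: nearW => n; rewrite Lpn_ge0 /=.
    pose tl (i : 'I_n) x := \sum_(Q \in P i) cell_weight Q * cind (tail_part Q n) x.
    have mtl i : cmeasurable setT (tl i).
      apply: cmeasurable_fsum; first exact: grid_finite gridP i.
      by move=> Q PQ; exact: measurable_tail_part PQ.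
    have -> : (fun x => f x * cind Om x - \sum_(k < n) level_sum m G s p slice_coef k x) =
        (fun x => rem n x * cind Om x + \sum_(i < n) tl i x).
      by apply/funext => x; rewrite -slice_remainder /rem mulrBl addrA subrK.
    have mrO := cmeasurableM (mrem n) mO.
    apply: le_trans (LpnD _ p1 mrO (cmeasurable_sum _ mtl)) _.
    apply: leeD; first by apply: le_Lpn => // x; exact: le_cind.
    apply: le_trans (Lpn_sum _ _ p1 mtl) _.
    apply: (@le_trans _ _ (\sum_(i < n) ((K / (1 - theta)) `^ p^-1 *
        ((c2 `^ s) ^+ n * lam ^+ (n - i)) * level_norm P p dc i)%:E)%E).
      by apply: lee_sum => i _; apply: Lpn_tail_part; exact: ltnW.
    rewrite sumEFin lee_fin.
    rewrite (eq_bigr (fun i : 'I_n => (K / (1 - theta)) `^ p^-1 * (c2 `^ s) ^+ n *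
        (lam ^+ (n - i) * level_norm P p dc i))); last first.
      by move=> i _; rewrite -!mulrA.
    rewrite -mulr_sumr /B [leRHS]mulrAC; apply: ler_wpM2l.
      by rewrite mulr_ge0 ?powR_ge0// exprn_ge0// ltW.
    (* The sum over i < n is [geom_conv] at n without its nonnegative last term i = n. *)
    apply: le_trans (convM n); rewrite /geom_conv big_ord_recr /= lerDl.
    by rewrite mulr_ge0 ?exprn_ge0 ?level_norm_ge0// ltW.
Qed.

End Slicing.

(** * Signs of the constants, and assembly over the branches *)

Section Nonnegativity.
Context {R : realType}.

(** Every factor other than [CRP] is a real power, nonnegative whatever the sign of its base. *)
Lemma Theta_ge0 (eps p gamma : R) a CG1 CG2 CC1 CC2 CRP : 0 <= CRP ->
  0 <= Theta eps p gamma a CG1 CG2 CC1 CC2 CRP.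
Proof. by move=> CRP0; rewrite /Theta !mulr_ge0 ?powR_ge0. Qed.

Lemma coef_norm_ge0 d (T : measurableType d) (G : @gridT d T) p q (c : set T -> R[i]) :
  (0 <= coef_norm G p q c)%E.
Proof. by apply: lq_ge0 => k; rewrite lee_fin level_norm_ge0. Qed.

(* Each [h^-1 Q] contains a cell of [H], so the potential bound is tested on at
   least one pair [(W, Q)]. *)
Lemma regular_potential_ge0 (dJ dI : measure_display)
    (TJ : measurableType dJ) (TI : measurableType dI)
    (mu : probability TJ R) (H : @gridT _ TJ) (m : probability TI R)
    (P G : @gridT _ TI) (c1 c2 s p : R) (q : \bar R) a eps CG1 CG2 CC1 CC2
    (Jh : set TJ) (Ih : set TI) (h : TJ -> TI) (g : TJ -> R[i]) CRP beta :
  good_grid mu H c1 c2 ->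
  branch mu H m P s p a eps CG1 CG2 CC1 CC2 G Jh Ih h ->
  regular_potential mu H m s p q G Jh Ih h g CRP beta eps ->
  0 <= CRP.
Proof.
move=> gridH [[[mJ mI _ mh _] _ [_ gridG [k [Q GQ]] _]] [_ regG _ _ _]] regg.
have [QI mQ mQ0] := gridG _ _ GQ.
have [k0 [[[W [HW Wsub]] _] _]] := regG _ _ GQ.
have mpre : measurable (Defs.preim Jh h Q) by exact: mh.
have W0 := grid_msr_gt0 gridH HW.
have pre0 : 0 < msr mu (Defs.preim Jh h Q).
  by apply: lt_le_trans W0 _; apply: le_msr => //; exact: grid_measurable gridH _ _ HW.
have Q0 : 0 < msr m Q by rewrite -lte_fin msrE.
have WJ : W `<=` Jh by move=> x /Wsub[].
have hWQ : h @` W `<=` Q by move=> _ [x /Wsub[_ ?] <-].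
have leC := regg _ _ _ _ HW GQ WJ QI hWQ.
have : (0 <= (CRP * (msr m Q / msr mu (Defs.preim Jh h Q)) `^ (p^-1 - s + eps)
    * msr mu W `^ (p^-1 - beta))%:E :> \bar R)%E.
  apply: le_trans leC; apply: le_ereal_inf_tmp => _ [c _ <-].
  exact: coef_norm_ge0.
by rewrite lee_fin !pmulr_lge0 ?powR_gt0// divr_gt0.
Qed.

End Nonnegativity.

(** For (S1) at a fixed level: slice norms bounded uniformly in r cost only the sum of the Theta_r.
    Its finiteness keeps [fine] from returning 0 on +oo. *)
Lemma esum_mul_le (R : realType) (Lam : set nat) (th u : nat -> R) (B : R) :
  0 <= B -> (forall r, Lam r -> 0 <= th r) -> (forall r, Lam r -> u r <= B) ->
  (\esum_(r in Lam) (th r)%:E < +oo)%E ->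
  (\esum_(r in Lam) (th r * u r)%:E <=
   (fine (\esum_(r in Lam) (th r)%:E) * B)%:E)%E.
Proof.
move=> B0 th0 uB thoo.
have sum0 : (0 <= \esum_(r in Lam) (th r)%:E)%E.
  by apply: esum_ge0 => r /th0; rewrite lee_fin.
apply: ge_ereal_sup => _ [A [finA AL] <-].
rewrite EFinM fineK ?ge0_fin_numE//.
have AB : (\sum_(r \in A) (th r * u r)%:E <= (\sum_(r \in A) (th r)%:E) * B%:E)%E.
  rewrite !fsbig_finite// !sumEFin -EFinM lee_fin mulr_suml big_seq [leRHS]big_seq.
  apply: ler_sum => r; rewrite in_fset_set// => /set_mem/AL Lr.
  by rewrite ler_wpM2l ?th0 ?uB.
apply: le_trans AB _; apply: lee_wpmul2r; first by rewrite lee_fin.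
by apply: ereal_sup_ubound; exists A.
Qed.

Theorem mainTheorem5 (R : realType)
    (dI : measure_display) (TI : measurableType dI) (m : probability TI R)
    (P : @gridT _ TI) (c1 c2 : R) (s beta p : R) (q : \bar R) :
  good_grid m P c1 c2 ->
  1 <= p -> (1 <= q)%E -> 0 < s -> s < beta -> beta < p^-1 ->
  exists CGSR : R, 0 <= CGSR /\
  forall (dJ : measure_display) (TJ : measurableType dJ) (mu : probability TJ R)
    (H : @gridT _ TJ) (c1' c2' : R) (eps gamma delta : R) (Lam : set nat)
    (Ir : nat -> set TI) (Jr : nat -> set TJ) (h : nat -> TJ -> TI)
    (g : nat -> TJ -> R[i]) (G : nat -> @gridT _ TI) (a : nat -> nat)
    (epsr CG1 CG2 CC1 CC2 CRP : nat -> R) (Crp : R),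
  (* standing assumptions *)
  good_grid mu H c1' c2' ->
  0 < eps -> 0 <= gamma <= 1 -> 0 < delta -> delta < Num.max s eps ->
  s + eps <= p^-1 ->
  (forall r, Lam r -> `|epsr r| = eps) ->
  (forall r, Lam r ->
     branch mu H m P s p (a r) (epsr r) (CG1 r) (CG2 r) (CC1 r) (CC2 r) (G r)
            (Jr r) (Ir r) (h r)) ->
  (forall r, Lam r ->
     regular_potential mu H m s p q (G r) (Jr r) (Ir r) (h r) (g r)
            (CRP r) beta (epsr r)) ->
  (forall A, measurable A <->
     <<s [set Q | exists r j, [/\ Lam r, G r j Q & Q `<=` Ir r]] `|`
         [set Q | in_grid P Q /\ forall r, Lam r -> Q `&` Ir r = set0] >> A) ->
  (exists kappa : R, kappa < 1 /\
     forall r, Lam r -> CDRS2 eps p (CG2 r) (CC2 r) <= kappa) ->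
  (exists C0 : R, 0 <= C0 /\
     forall f : TI -> R[i], inLp m (p / (1 - s * p + delta * p)) f ->
       (\esum_(r in Lam) Lpn mu 1 (transfer (Jr r) (h r) (g r) f)
          <= C0%:E * Lpn m (p / (1 - s * p + delta * p)) f)%E) ->
  (* Assumption PLAIN *)
  (forall r k, Lam r -> G r k = [set Q | P k Q /\ Q `<=` Ir r]) ->
  (* hypotheses of the theorem *)
  0 < Crp ->
  (forall r r', Lam r -> Lam r' -> r <> r' -> Ir r `&` Ir r' = set0) ->
  (forall r, Lam r -> strongly_regular m P (1 - beta * p) Crp 0 (Ir r)) ->
  (\esum_(r in Lam)
     (Theta eps p gamma (a r) (CG1 r) (CG2 r) (CC1 r) (CC2 r) (CRP r))%:E < +oo)%E ->
  forall (f : TI -> R[i]) (dc : set TI -> R[i]),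
    besov_rep m P s p q f dc ->
    regular_slicing m P s p q Lam Ir G
      (fun r => Theta eps p gamma (a r) (CG1 r) (CG2 r) (CC1 r) (CC2 r) (CRP r))
      (overlapN H Lam Jr)
      (CGSR * (Crp `^ p^-1 *
         fine (\esum_(r in Lam)
           (Theta eps p gamma (a r) (CG1 r) (CG2 r) (CC1 r) (CC2 r) (CRP r))%:E)))
      f dc.
Proof.
move=> gridP p1 q1 s0 sbeta _.
have lam01 : 0 < c2 `^ (beta - s) < 1.
  by apply: (powR_ratio_lt1 gridP); rewrite subr_gt0.
have [lam0 lam1] := andP lam01.
(* The constant 1 / (1 - lam) of Young's inequality, which involves only the grid ratio [c2], s and
   beta. *)
exists (1 - c2 `^ (beta - s))^-1; split; first by rewrite invr_ge0 subr_ge0 ltW.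
move=> dJ TJ mu H c1' c2' eps gamma delta Lam Ir Jr h g G a epsr CG1 CG2 CC1 CC2
  CRP K gridH _ _ _ _ _ _ brG regg _ _ _ plain K0 _ strongI Thoo f dc repf.
set Th := fun r => Theta _ _ _ _ _ _ _ _ _.
have Th0 r : Lam r -> 0 <= Th r.
  move=> Lr; apply: Theta_ge0.
  exact: (regular_potential_ge0 gridH (brG _ Lr) (regg _ Lr)).
have GE r : Lam r -> G r = sub_grid P (Ir r).
  by move=> Lr; apply/funext => k; exact: plain.
(* One decomposition is chosen per branch and cell. Its properties do not mention the level of the
   cell, so the choice depends on the set alone; irrelevant pairs get empty families. *)
have /choice[F HF] : forall rQ : nat * set TI, exists F : @gridT _ TI,
    forall i, Lam rQ.1 -> P i rQ.2 -> decomp P (rQ.2 `&` Ir rQ.1) F /\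
      forall k, \sum_(S \in F k) msr m S `^ (1 - beta * p)
        <= K * msr m rQ.2 `^ (1 - beta * p).
  move=> [r Q] /=; have [[Lr [i PQ]]|nLQ] := pselect (Lam r /\ exists i, P i Q).
    by have [F [dF sF]] := strongI r Lr i Q (leq0n i) PQ; exists F.
  by exists (fun=> set0) => i Lr PQ; case: nLQ; split=> //; exists i.
have mI r : Lam r -> measurable (Ir r) by move=> /brG[[[]]].
have dF r (Lr : Lam r) i Q (PQ : P i Q) : decomp P (Q `&` Ir r) (F (r, Q)).
  exact: (HF (r, Q) i Lr PQ).1.
have sF r (Lr : Lam r) i Q k (PQ : P i Q) :
    \sum_(S \in F (r, Q) k) msr m S `^ (1 - beta * p)
      <= K * msr m Q `^ (1 - beta * p).
  exact: (HF (r, Q) i Lr PQ).2.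
exists (fun r => slice_coef m P s p (fun Q => F (r, Q)) dc); split.
- move=> r Lr; rewrite (GE r Lr).
  exact (slice_besov_rep gridP p1 s0 sbeta (F := fun Q => F (r, Q))
    (mI r Lr) K0 (dF r Lr) (sF r Lr) q1 repf).
(* (S1) holds: at level k all slices share the bound K^(1/p) times the convolution, the sum of the
   Theta_r factors out, and [lq_geom_conv] handles the l^q norm. *)
- left.
  have K'0 : 0 <= K `^ p^-1 by exact: powR_ge0.
  have ThS0 : 0 <= fine (\esum_(r in Lam) (Th r)%:E).
    by apply: fine_ge0; apply: esum_ge0 => r /Th0; rewrite lee_fin.
  have -> : (1 - c2 `^ (beta - s))^-1 * (K `^ p^-1 * fine (\esum_(r in Lam) (Th r)%:E)) =
      fine (\esum_(r in Lam) (Th r)%:E) * K `^ p^-1 / (1 - c2 `^ (beta - s)).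
    by rewrite mulrC; congr (_ / _); rewrite mulrC.
  apply: lq_geom_conv => //.
  + by rewrite mulr_ge0.
  + by move=> k; exact: level_norm_ge0.
  + by move=> k; apply: esum_ge0 => r Lr; rewrite lee_fin mulr_ge0 ?level_norm_ge0 ?Th0.
  + move=> k; rewrite -mulrA; apply: esum_mul_le => //.
      by rewrite mulr_ge0// geom_conv_ge0// => j; exact: level_norm_ge0.
    move=> r Lr; rewrite (GE r Lr).
    exact (slice_norm gridP p1 sbeta (F := fun Q => F (r, Q)) K0
      (dF r Lr) (sF r Lr) dc k).
- move=> dc0 r j Q Lr; rewrite (GE r Lr) => -[PQ _].
  exact: (slice_coef_ge0 _ _ gridP _ dc0 PQ).
Qed.
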